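(* Let $Y\to X$ be a smooth fiber bundle, $\dim X=n$, and for vector bundles $A\to Y$, $B\to Y$ let $\mathrm{Diff}(A,B)$ denote the set of linear $B$-valued differential operators on $A\to Y\to X$. Let $E'\to Y$, $E\to Y$, $Q\to Y$ be vector bundles, with density-duals $\overline{E'}^*,\overline E^*,\overline Q^*$. Then for all $\upsilon\in\mathrm{Diff}(E,Q)$ and $\upsilon'\in\mathrm{Diff}(E',E)$, $$\eta(\upsilon\circ\upsilon')=\eta(\upsilon')\circ\eta(\upsilon),$$ and for all $\Delta\in\mathrm{Diff}(\overline Q^*,\overline E^* )$ and $\Delta'\in\mathrm{Diff}(\overline E^*,\overline{E'}^* )$, $$\eta(\Delta'\circ\Delta)=\eta(\Delta)\circ\eta(\Delta').$$
   Context: $Y\to X$ has bundle coordinates $(x^\lambda,y^i)$; $J^kY$ are its jet manifolds with jet coordinates $y^i_\Lambda$, $\Lambda=(\lambda_k\ldots\lambda_1)$ a symmetric multi-index of length $|\Lambda|=k$; $\Sigma+\Lambda$ is concatenation. $\omega=dx^1\wedge\cdots\wedge dx^n$. Total derivatives are $d_\lambda=\partial_\lambda+\sum_{0\le|\Lambda|}y^i_{\lambda+\Lambda}\partial^\Lambda_i$ (sum over distinct jet coordinates; similarly including all other fiber coordinates on jets of bundles over $Y$), and $d_\Lambda=d_{\lambda_k}\circ\cdots\circ d_{\lambda_1}$. The density-dual of a vector bundle $E\to Y$ is $\overline E^*=E^*\otimes_Y\bigwedge^nT^*X$. A linear differential operator on $W\to Y\to X$ with values in $Z$ (for vector bundles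 $W,Z\to Y$) is a bundle morphism $J^kW\to Z$ over $Y$, for some $k$, linear on the fibers of $J^kW\to J^kY$; its coefficients are local functions on a finite order jet manifold of $Y$. Operators are composed using total derivatives: if $\upsilon^a=\sum_\Lambda\upsilon^{a,\Lambda}_r\xi^r_\Lambda$ and $\upsilon'^r=\sum_\Sigma\upsilon'^{r,\Sigma}_p\epsilon^p_\Sigma$, then $(\upsilon\circ\upsilon')^a=\sum_\Lambda\upsilon^{a,\Lambda}_r\,d_\Lambda\big(\sum_\Sigma\upsilon'^{r,\Sigma}_p\epsilon^p_\Sigma\big)$. Convention: operator coefficients are symmetric in the indices of $\Lambda$, and sums over $\Lambda$, $\Sigma$ run over all ordered tuples of indices. $C^a_b=\frac{b!}{a!(b-a)!}$. The intertwining operator $\eta$: for vector bundles $E,Q\to Y$ with fiber coordinates $\xi^r$, $q^a$ (dual coordinates $q_a$ on $Q^*$, and $\overline q_a$ on $\overline Q^*$), an operator in $\mathrm{Diff}(E,Q)$ is represented as $\upsilon=\sum_{|\Lambda|\le m}\upsilon^{a,\Lambda}_r\xi^r_\Lambda q_a$ and an operator in $\mathrm{Diff}(\overline Q^*,\overline E^* )$ as the density $\Delta=\sum_{|\Lambda|\le m}\Delta^{a,\Lambda}_r\overline q_{\Lambda a}\xi^r\omega$. Then $\eta:\mathrm{Diff}(E,Q)\to\mathrm{Diff}(\overline Q^*,\overline E^* )$ is given by $$\eta(\upsilon)=\sum_{0\le|\Sigma|\le m}(-1)^{|\Sigma|}d_\Sigma(\upsilon^{a,\Sigma}_r\overline q_a)\xi^r\omega,\qquad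 \eta(\upsilon)^{a,\Lambda}_r=\sum_{0\le|\Sigma|\le m-|\Lambda|}(-1)^{|\Sigma+\Lambda|}C^{|\Sigma|}_{|\Sigma+\Lambda|}d_\Sigma\upsilon^{a,\Sigma+\Lambda}_r,$$ and $\eta:\mathrm{Diff}(\overline Q^*,\overline E^* )\to\mathrm{Diff}(E,Q)$ by $$\eta(\Delta)=\sum_{0\le|\Sigma|\le m}(-1)^{|\Sigma|}d_\Sigma(\Delta^{a,\Sigma}_r\xi^r)q_a,\qquad \eta(\Delta)^{a,\Lambda}_r=\sum_{0\le|\Sigma|\le m-|\Lambda|}(-1)^{|\Sigma+\Lambda|}C^{|\Sigma|}_{|\Sigma+\Lambda|}d_\Sigma\Delta^{a,\Sigma+\Lambda}_r.$$ These local expressions are globally well defined. *)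

(* Defs.v *)
From HB Require Import structures.
From mathcomp Require Import all_boot all_order all_algebra.
From mathcomp Require Import all_classical all_reals all_analysis.

Set Implicit Arguments.
Unset Strict Implicit.
Unset Printing Implicit Defensive.

Import Order.TTheory GRing.Theory Num.Theory numFieldNormedType.Exports.
Local Open Scope classical_set_scope.
Local Open Scope ring_scope.

Section Calculus.
Variables (R : realType) (J : eqType).
Implicit Types (p : J -> R) (f : (J -> R) -> R) (U : set (J -> R)).

Definition upd p (c : J) (t : R) : J -> R := fun c' => if c' == c then t else p c'.

Definition pder (c : J) f : (J -> R) -> R :=
  fun p => derive1 (fun t => f (upd p c t)) (p c).

Definition pders (s : seq J) f : (J -> R) -> R := foldr pder f s.

(** [U] is meant to be open in the product topology.  For finite [J] this is
    the usual notion of a smooth function on an open subset of R^J.  For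
    infinite [J] it is only used for functions of finitely many coordinates,
    for which it means smoothness in these coordinates. *)
Definition smooth_on U f : Prop :=
  forall (s : seq J) p, U p ->
    (forall c, derivable (fun t => pders s f (upd p c t)) (p c) 1) /\
    {for (p : {ptws J -> R}), continuous (pders s f : {ptws J -> R} -> R)}.

End Calculus.

Section Manifolds.
Variable R : realType.

(** A chart with coordinates indexed by [J].  The value of [cmap] outside
    [cdom], and that of [cinv] outside the image of [cdom], are irrelevant. *)
Record chart (T : Type) (J : Type) := Chart {
  cdom : set T;
  cmap :> T -> J -> R;
  cinv : (J -> R) -> T }.

Definition is_chart (T : topologicalType) (J : finType) (c : chart T J) : Prop :=
  [/\ open (cdom c),
      open (c @` cdom c : set {ptws J -> R}),
      (forall z, cdom c z -> cinv c (c z) = z),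
      (forall z, cdom c z -> {for z, continuous (c : T -> {ptws J -> R})}) &
      (forall z, cdom c z ->
         {for (c z : {ptws J -> R}), continuous (cinv c : {ptws J -> R} -> T)})].

Definition smooth_trans (T : Type) (J J' : finType)
    (c : chart T J) (c' : chart T J') : Prop :=
  forall k : J',
    smooth_on (c @` (cdom c `&` cdom c')) (fun u => c' (cinv c u) k).

Record manifold (J : finType) := Manifold {
  mspace :> topologicalType;
  atlas : set (chart mspace J) }.

(** Charts of the maximal atlas. *)
Definition mchart (J : finType) (M : manifold J) (c : chart M J) : Prop :=
  is_chart c /\
  forall c', atlas c' -> smooth_trans c c' /\ smooth_trans c' c.

Definition is_manifold (J : finType) (M : manifold J) : Prop :=
  [/\ hausdorff_space M, @second_countable M,
      (forall c, @atlas J M c -> mchart c) &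
      (forall z : M, exists2 c, @atlas J M c & cdom c z)].

(** A fiber bundle Y -> X with typical fiber F, dim X = n, dim F = m, together
    with a family of bundle coordinates (x^l, y^i) of Y, indexed by [bI]. *)
Record fbundle (n m : nat) := Fbundle {
  base : manifold 'I_n;
  total : manifold ('I_n + 'I_m)%type;
  tfiber : manifold 'I_m;
  proj : total -> base;
  bI : Type;
  xchart : bI -> chart base 'I_n;
  ychart : bI -> chart total ('I_n + 'I_m)%type }.

(** (proj, phi) is a diffeomorphism of proj^-1(U) onto U * F: it is bijective,
    and it pulls the product charts back to charts of the manifold Y. *)
Definition local_trivialization n m (B : fbundle n m)
    (U : set (base B)) (phi : total B -> tfiber B) : Prop :=
  [/\ open U,
      (forall x z, U x -> exists! y, proj y = x /\ phi y = z) &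
      (forall (c : chart (base B) 'I_n) (d : chart (tfiber B) 'I_m),
         atlas c -> atlas d ->
         exists e : chart (total B) ('I_n + 'I_m)%type,
         [/\ mchart e,
             cdom e = [set y | [/\ U (proj y), cdom c (proj y) & cdom d (phi y)]],
             (forall y l, cdom e y -> e y (inl l) = c (proj y) l) &
             (forall y i, cdom e y -> e y (inr i) = d (phi y) i)])].

Definition is_fbundle n m (B : fbundle n m) : Prop :=
  [/\ [/\ is_manifold (base B), is_manifold (total B) & is_manifold (tfiber B)],
      (forall x : base B, exists y : total B, proj y = x),
      (forall x : base B, exists U (phi : total B -> tfiber B),
         U x /\ local_trivialization U phi),
      (forall y : total B, exists i : bI B, cdom (ychart i) y) &
      (forall i : bI B, [/\ mchart (xchart i), mchart (ychart i),
         (forall y, cdom (ychart i) y -> cdom (xchart i) (proj y)) &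
         (forall y l, cdom (ychart i) y ->
            ychart i y (inl l) = xchart i (proj y) l)])].

(** A vector bundle over Y, given by its linear transition functions over the
    bundle charts of Y: the fiber coordinates transform as
    [xi_j = vtrans j i y *m xi_i].  (Finitely many vector bundles over Y are
    always simultaneously trivial over the charts of some adapted atlas.) *)
Record vbundle n m (B : fbundle n m) := Vbundle {
  vrank : nat;
  vtrans : bI B -> bI B -> total B -> 'M[R]_vrank }.

Definition is_vbundle n m (B : fbundle n m) (E : vbundle B) : Prop :=
  [/\ (forall i y, cdom (ychart i) y -> vtrans E i i y = 1%:M),
      (forall i j k y, cdom (ychart i) y -> cdom (ychart j) y ->
         cdom (ychart k) y ->
         vtrans E k j y *m vtrans E j i y = vtrans E k i y) &
      (forall i j r s,
         smooth_on (ychart i @` (cdom (ychart i) `&` cdom (ychart j)))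
                   (fun u => vtrans E j i (cinv (ychart i) u) r s))].

(** Jacobian matrix of the coordinates [c] with respect to the coordinates
    [c'], at the point [x]. *)
Definition jacobian (T : Type) n (c c' : chart T 'I_n) (x : T) : 'M[R]_n :=
  \matrix_(l, k) pder k (fun u => c (cinv c' u) l) (c' x).

(** The density-dual of E, tensor product of E^* with /\^n T^*X.  An element with
    coordinates p in the chart i sends xi to (p_r xi^r) dx_i^1 /\ ... /\ dx_i^n,
    and dx_i^1 /\ ... /\ dx_i^n is det(dx_i / dx_j) dx_j^1 /\ ... /\ dx_j^n. *)
Definition ddual n m (B : fbundle n m) (E : vbundle B) : vbundle B :=
  {| vrank := vrank E;
     vtrans := fun j i y =>
       \det (jacobian (xchart i) (xchart j) (proj y))
         *: (invmx (vtrans E j i y))^T |}.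

End Manifolds.

(** Symmetric multi-indices are encoded by their multiplicities. *)
Definition midx n := {ffun 'I_n -> nat}.
Definition mdeg n (M : midx n) : nat := (\sum_i M i)%N.
Definition midx0 n : midx n := [ffun=> 0%N].
Definition midxS n (l : 'I_n) (M : midx n) : midx n :=
  [ffun i => ((i == l) + M i)%N].

(** The symmetric multi-index underlying an ordered tuple of indices. *)
Definition midx_of n (s : seq 'I_n) : midx n := [ffun i => count_mem i s].

(** The coordinates x^l and y^k_M, on the jets of all orders, for a bundle over
    X with fiber coordinates y^k, k in K.  Functions on a jet manifold J^k are
    treated as functions of all the jet coordinates that only depend on those of
    order at most k. *)
Definition jidx n (K : Type) : Type := ('I_n + K * midx n)%type.

Section Jets.
Variables (R : realType) (n : nat).

Definition jorder (K : Type) (c : jidx n K) : nat :=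
  match c with inl _ => 0%N | inr kM => mdeg kM.2 end.

Definition order_le (K : Type) (k : nat) (U : set (jidx n K -> R))
    (f : (jidx n K -> R) -> R) : Prop :=
  forall p p', U p -> U p' ->
    (forall c, (jorder c <= k)%N -> p c = p' c) -> f p = f p'.

(** The total derivative d_l; at each point the sum is finitely supported when
    [f] has finite order. *)
Definition tder (K : choiceType) (l : 'I_n) (f : (jidx n K -> R) -> R) :
    (jidx n K -> R) -> R :=
  fun p => pder (inl l) f p +
    \sum_(c \in [set: K * midx n])
      p (inr (c.1, midxS l c.2)) * pder (inr c) f p.

Definition tders (K : choiceType) (s : seq 'I_n) (f : (jidx n K -> R) -> R) :
    (jidx n K -> R) -> R := foldr (@tder K) f s.

Variable m : nat.

(** The point of Y below a jet of sections of Y. *)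
Definition jbase (p : jidx n 'I_m -> R) : ('I_n + 'I_m)%type -> R :=
  fun c => match c with
           | inl l => p (inl l)
           | inr i => p (inr (i, midx0 n))
           end.

(** Jets of sections of W -> X, for W -> Y of rank r with fiber coordinates xi^r:
    the projection J^kW -> J^kY, and the jet with given projection [p] and given
    coordinates [v] of type xi^r_M. *)
Definition wjidx (r : nat) := jidx n ('I_m + 'I_r)%type.

Definition jproj r (p : wjidx r -> R) : jidx n 'I_m -> R :=
  fun c => match c with
           | inl l => p (inl l)
           | inr (i, M) => p (inr (inl i, M))
           end.

Definition jlift r (p : jidx n 'I_m -> R) (v : 'I_r * midx n -> R) : wjidx r -> R :=
  fun c => match c with
           | inl l => p (inl l)
           | inr (inl i, M) => p (inr (i, M))
           | inr (inr s, M) => v (s, M)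
           end.

(** If [f = \sum_Lambda c^Lambda_r xi^r_Lambda], where Lambda runs over all
    ordered tuples and c is symmetric in the indices of Lambda, this is
    c^Lambda_r: the coefficient of the jet coordinate xi^r_M, M the symmetric
    multi-index of Lambda, is shared evenly between the |M|! / \prod_i M_i!
    ordered tuples with that multi-index. *)
Definition coef r (f : (wjidx r -> R) -> R) (s : 'I_r) (L : seq 'I_n) :
    (jidx n 'I_m -> R) -> R :=
  fun p => (\prod_i (midx_of L i)`!)%:R / (size L)`!%:R *
           f (jlift p (fun c => (c == (s, midx_of L))%:R)).

(** upsilon \o upsilon' and eta(upsilon) in one chart.  The index of type
    ['I_z] is the output component; the sums over [L] run over all ordered
    tuples, and are finitely supported for operators of finite order. *)
Definition lcomp r s z
    (u : 'I_z -> (wjidx s -> R) -> R) (u' : 'I_s -> (wjidx r -> R) -> R) :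
    'I_z -> (wjidx r -> R) -> R :=
  fun a p => \sum_(L \in [set: seq 'I_n])
    \sum_(k < s) coef (u a) k L (jproj p) * tders L (u' k) p.

Definition leta r z (u : 'I_z -> (wjidx r -> R) -> R) :
    'I_r -> (wjidx z -> R) -> R :=
  fun k p => \sum_(L \in [set: seq 'I_n])
    (-1) ^+ size L *
    tders L (fun q => \sum_(a < z)
               coef (u a) k L (jproj q) * q (inr (inr a, midx0 n))) p.

End Jets.

Section Operators.
Variables (R : realType) (n m : nat) (B : fbundle R n m).

(** Coordinate expressions, in every chart, of maps J^kW -> Z over Y. *)
Definition opfam (W Z : vbundle B) : Type :=
  bI B -> 'I_(vrank Z) -> (wjidx n m (vrank W) -> R) -> R.

(** The coordinate image of the jets of Y (resp. of W) lying over the chart i. *)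
Definition jdom (i : bI B) : set (jidx n 'I_m -> R) :=
  [set p | (ychart i @` cdom (ychart i)) (jbase p)].
Definition wjdom (r : nat) (i : bI B) : set (wjidx n m r -> R) :=
  [set p | jdom i (jproj p)].

(** Fiber coordinates, in the chart i, of the section of W -> X formed by a
    section s of Y -> X and components w in the frame of W over the chart i. *)
Definition sec_coord r (i : bI B) (s : base B -> total B)
    (w : base B -> 'cV[R]_r) (k : 'I_m + 'I_r) (x : base B) : R :=
  match k with
  | inl k => ychart i (s x) (inr k)
  | inr k => w x k 0
  end.

Definition smooth_section r (i : bI B) (U : set (base B))
    (s : base B -> total B) (w : base B -> 'cV[R]_r) : Prop :=
  forall k, smooth_on (xchart i @` U)
              (fun u => sec_coord i s w k (cinv (xchart i) u)).

Definition jet r (i : bI B) (s : base B -> total B) (w : base B -> 'cV[R]_r)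
    (x : base B) : wjidx n m r -> R :=
  fun c => match c with
  | inl l => xchart i x l
  | inr (k, M) =>
      pders (flatten [seq nseq (M l) l | l <- enum 'I_n])
        (fun u => sec_coord i s w k (cinv (xchart i) u)) (xchart i x)
  end.

(** Diff(W, Z): the coordinate expressions are smooth functions on J^kW, linear
    on the fibers of J^kW -> J^kY, and on the overlaps of charts they define the
    same element of Z when evaluated on the jet of any section of W -> X. *)
Definition Diff (W Z : vbundle B) : set (opfam W Z) :=
  [set F | [/\
    (exists k, forall i a,
      [/\ order_le k (wjdom (r := vrank W) i) (F i a),
          smooth_on (wjdom (r := vrank W) i) (F i a) &
          forall p v v' (t : R), jdom i p ->
            F i a (jlift p (fun c => t * v c + v' c)) =
            t * F i a (jlift p v) + F i a (jlift p v')]) &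
    (forall i j (U : set (base B)) (s : base B -> total B)
            (w : base B -> 'cV[R]_(vrank W)),
      open U ->
      (forall x, U x -> [/\ proj (s x) = x, cdom (ychart i) (s x)
                          & cdom (ychart j) (s x)]) ->
      smooth_section i U s w ->
      forall x, U x ->
        \col_a F j a (jet j s (fun x' => vtrans W j i (s x') *m w x') x) =
        vtrans Z j i (s x) *m \col_a F i a (jet i s w x))]].

(** Coordinate expressions are only meaningful at jets lying over their chart. *)
Definition op_eq (W Z : vbundle B) (F G : opfam W Z) : Prop :=
  forall i a p, wjdom i p -> F i a p = G i a p.

Definition op_comp (W V Z : vbundle B) (u : opfam V Z) (u' : opfam W V) :
  opfam W Z := fun i => lcomp (u i) (u' i).

Definition eta (E Q : vbundle B) (u : opfam E Q) : opfam (ddual Q) (ddual E) :=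
  fun i => leta (u i).

Definition eta_dual (E Q : vbundle B) (D : opfam (ddual Q) (ddual E)) :
  opfam E Q := fun i => leta (D i).

End Operators.

Arguments Diff {R n m B} W Z _.

(* Main.v *)
From HB Require Import structures.
Require Import Defs.
From mathcomp Require Import all_boot all_order all_algebra.
From mathcomp Require Import all_classical all_reals all_analysis.
From mathcomp Require Import ring lra.

(** In one chart, the smooth functions of finite order on the jets form a
    commutative ring with commuting derivations d_l, and a linear operator is a
    finite sum of terms a * d_w.  Let T(F, h) be the adjoint of F applied to h:
    it is additive in both arguments, and T(d_l F, h) = - T(F, d_l h) and
    T(a F, h) = T(F, a h).  The adjoint of the composite of F with the family F'_s
    therefore sends h to the sum over s of T(F'_s, T_s(F, h)), where T_s is the
    adjoint of the part of F that acts on the s-th component.  The calculus behind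
    this is the symmetry of second partial derivatives. *)

Set Implicit Arguments.
Unset Strict Implicit.
Unset Printing Implicit Defensive.

Import Order.TTheory GRing.Theory Num.Theory numFieldNormedType.Exports.
Local Open Scope classical_set_scope.
Local Open Scope ring_scope.

(** * Convergence and single-coordinate updates in the product topology on R^J *)

Section ProductTopology.
Variables (R : realType) (J : eqType).
Implicit Types (p : {ptws J -> R}) (c : J) (U : set {ptws J -> R}).

(** The theorem is local: in each chart it is one identity about [leta] and [lcomp], and both halves
    are instances of it. Three things separate the definitions from the algebra. The coefficients of
    an operator live on jets of Y, while its arguments live on jets of a vector bundle over Y; so
    there are two rings, linked by a pullback that commutes with total derivatives. The definitions
    differentiate raw functions that are meaningful only over the chart; the rings consist of
    functions set to zero elsewhere, which turns the rules of calculus into plain equations.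
    Finally, the defining sums run over all ordered tuples with symmetrized coefficients, while the
    algebra works with arbitrary finite lists of words; the multinomial weights cancel the number of
    orderings of each multi-index, and additivity alone then leads from one form to the other. *)

Lemma ptws_cvg (F : set_system {ptws J -> R}) p : Filter F ->
  (forall j, (fun q => q j) @ F --> p j) -> F --> p.
Proof.
move=> FF h; apply/(@cvg_sup {ptws J -> R} J _ F p) => j A.
rewrite nbhsE => -[B [[C oC <-] Cp] sBA].
apply: filterS sBA _.
by apply: (h j C); rewrite nbhsE; exists C.
Qed.

Lemma ptws_continuous_at (T : topologicalType) (g : T -> {ptws J -> R}) (x : T) :
  (forall j, {for x, continuous (fun y => g y j)}) -> {for x, continuous g}.
Proof.
by move=> h; apply: ptws_cvg => j; apply: (h j).
Qed.

Lemma ptws_coord_continuous j p : {for p, continuous (fun q : {ptws J -> R} => q j)}.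
Proof. exact: (@proj_continuous J (fun=> R) j). Qed.

Lemma upd_id p c : upd p c (p c) = p.
Proof. by apply/funext => j; rewrite /upd; case: eqP => [->|]. Qed.

Lemma upd_same p c t : upd p c t c = t.
Proof. by rewrite /upd eqxx. Qed.

Lemma upd_neq p c d t : d != c -> upd p c t d = p d.
Proof. by rewrite /upd => /negbTE ->. Qed.

Lemma upd_upd p c s t : upd (upd p c s) c t = upd p c t.
Proof. by apply/funext => j; rewrite /upd; case: eqP. Qed.

Lemma updC p c d s t : c != d -> upd (upd p c s) d t = upd (upd p d t) c s.
Proof.
move=> cd; apply/funext => j; rewrite /upd.
by case: (j =P d) => [->|//]; rewrite eq_sym (negbTE cd).
Qed.

Lemma upd_continuous p c t :
  {for t, continuous (upd p c : R -> {ptws J -> R})}.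
Proof.
apply: ptws_continuous_at => j; rewrite /upd.
by case: eqP => _; [exact: cvg_id | exact: cvg_cst].
Qed.

Lemma upd2_continuous p c d (z : R * R) :
  {for z, continuous ((fun z => upd (upd p c z.1) d z.2) : R * R -> {ptws J -> R})}.
Proof.
apply: ptws_continuous_at => j; rewrite /upd.
case: eqP => _; first exact: cvg_snd.
by case: eqP => _; [exact: cvg_fst | exact: cvg_cst].
Qed.

Lemma near_upd U p c : open U -> U p -> \forall t \near p c, U (upd p c t).
Proof.
move=> oU Up; apply: (@upd_continuous p c (p c)).
by apply: open_nbhs_nbhs; split=> //; rewrite /= upd_id.
Qed.

End ProductTopology.

(** * Smooth functions on open subsets of R^J and their closure properties *)

Section Smooth.
Variables (R : realType) (J : eqType).
Implicit Types (p : J -> R) (c : J) (f g : (J -> R) -> R) (U : set (J -> R)).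

Definition smooth0_on U f : Prop :=
  forall p, U p -> (forall c, derivable (fun t => f (upd p c t)) (p c) 1) /\
    {for (p : {ptws J -> R}), continuous (f : {ptws J -> R} -> R)}.

Lemma pders_rcons s c f : pders (rcons s c) f = pders s (pder c f).
Proof. by rewrite /pders foldr_rcons. Qed.

Lemma smooth_on0 U f : smooth_on U f -> smooth0_on U f.
Proof. by move=> h; exact: (h [::]). Qed.

Lemma smooth_on_pder U f c : smooth_on U f -> smooth_on U (pder c f).
Proof. by move=> h s; move: (h (rcons s c)); rewrite pders_rcons. Qed.

Lemma pder_eq U f g c p : open (U : set {ptws J -> R}) ->
  (forall q, U q -> f q = g q) -> U p -> pder c f p = pder c g p.
Proof.
move=> oU fg Up; rewrite /pder !derive1E; apply: near_eq_derive.
by apply: filterS (near_upd c oU Up) => t; apply: fg.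
Qed.

Lemma pders_eq U f g s p : open (U : set {ptws J -> R}) ->
  (forall q, U q -> f q = g q) -> U p -> pders s f p = pders s g p.
Proof.
move=> oU fg; elim: s p => [|c s IH] p Up /=; first exact: fg.
exact: (@pder_eq U).
Qed.

Lemma smooth0_on_eq U f g : open (U : set {ptws J -> R}) ->
  (forall q, U q -> f q = g q) -> smooth0_on U f -> smooth0_on U g.
Proof.
move=> oU fg h p Up; have [h1 h2] := h p Up; split=> [c|].
  apply: near_eq_derivable (h1 c).
  by apply: filterS (near_upd c oU Up) => t; apply: fg.
rewrite /prop_for /continuous_at -(fg p Up).
have nU : nbhs (p : {ptws J -> R}) U by apply: open_nbhs_nbhs.
move=> A /h2 hA; rewrite nbhs_filterE /=.
have FF := nbhs_filter (p : {ptws J -> R}).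
by apply: filterS2 nU hA => q Uq /=; rewrite fg.
Qed.

(** Smoothness involves all iterated derivatives, so it is checked on a whole class of functions at
    once: if the class is stable under partial derivatives, first-order regularity of its members
    suffices. Stability up to equality on [U] is enough because derivatives are local. The induction
    peels off the derivative that is applied first, hence [last_ind]. *)
Lemma smooth_on_ind (P : ((J -> R) -> R) -> Prop) U :
  open (U : set {ptws J -> R}) ->
  (forall f, P f -> smooth0_on U f) ->
  (forall f c, P f -> exists2 g, P g & forall q, U q -> pder c f q = g q) ->
  forall f, P f -> smooth_on U f.
Proof.
move=> oU P0 PS f Pf s; elim/last_ind: s f Pf => [|s c IH] f Pf.
  exact: P0.
have [g Pg fg] := PS f c Pf; rewrite pders_rcons.
apply: (@smooth0_on_eq U (pders s g)) => //; last exact: IH.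
by move=> q Uq; apply: (@pders_eq U) => // q' Uq'; rewrite fg.
Qed.

Lemma smooth_on_eq U f g : open (U : set {ptws J -> R}) ->
  (forall q, U q -> f q = g q) -> smooth_on U f -> smooth_on U g.
Proof.
move=> oU fg h s; apply: (@smooth0_on_eq U (pders s f)) => //; last exact: h.
by move=> q Uq; apply: (@pders_eq U).
Qed.

Lemma pder_is_derive U f p c : smooth0_on U f -> U p ->
  is_derive (p c) 1 (fun t => f (upd p c t)) (pder c f p).
Proof.
by move=> h Up; rewrite /pder derive1E; apply: DeriveDef => //; apply: (h p Up).1.
Qed.

Lemma pderE f p c d : is_derive (p c) 1 (fun t => f (upd p c t)) d ->
  pder c f p = d.
Proof. by move=> [_ <-]; rewrite /pder derive1E. Qed.

Lemma pder_cst (a : R) c p : pder c (fun=> a) p = 0.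
Proof. by rewrite /pder derive1_cst. Qed.

Lemma pderD U f g p c : smooth0_on U f -> smooth0_on U g -> U p ->
  pder c (fun q => f q + g q) p = pder c f p + pder c g p.
Proof.
move=> hf hg Up; apply: pderE.
exact: (is_deriveD (pder_is_derive c hf Up) (pder_is_derive c hg Up)).
Qed.

Lemma pderM U f g p c : smooth0_on U f -> smooth0_on U g -> U p ->
  pder c (fun q => f q * g q) p = pder c f p * g p + f p * pder c g p.
Proof.
move=> hf hg Up; apply: pderE.
have := is_deriveM (pder_is_derive c hf Up) (pder_is_derive c hg Up).
by rewrite upd_id /GRing.scale /= addrC [g p * _]mulrC.
Qed.

Lemma pder_coord c d p : pder c (fun q : J -> R => q d) p = (d == c)%:R.
Proof.
apply: pderE; rewrite /upd; case: eqP => _; [exact: is_derive_id | exact: is_derive_cst].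
Qed.

(** The Leibniz rule turns a product into a sum of products, so the products alone are not a stable
    class. The algebra generated by the smooth functions is stable, and [smooth_on_ind] applies to
    it. *)
Inductive alg_on U : ((J -> R) -> R) -> Prop :=
| alg_smooth f : smooth_on U f -> alg_on U f
| alg_add f g : alg_on U f -> alg_on U g -> alg_on U (fun q => f q + g q)
| alg_mul f g : alg_on U f -> alg_on U g -> alg_on U (fun q => f q * g q).

Lemma alg_on_smooth U f : open (U : set {ptws J -> R}) -> alg_on U f -> smooth_on U f.
Proof.
move=> oU; move: f.
have P0 f : alg_on U f -> smooth0_on U f.
  elim=> {}f; first exact: smooth_on0.
    move=> g _ hf _ hg p Up; have [f1 f2] := hf p Up; have [g1 g2] := hg p Up.
    split=> [c|]; first exact: derivableD.
    exact: (@cvgD _ R _ _ _ _ _ _ _ f2 g2).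
  move=> g _ hf _ hg p Up; have [f1 f2] := hf p Up; have [g1 g2] := hg p Up.
  split=> [c|]; first exact: derivableM.
  exact: (@cvgM _ _ _ _ _ _ _ _ f2 g2).
apply: smooth_on_ind => // f c; elim=> {}f.
- by move=> h; exists (pder c f) => //; apply/alg_smooth/smooth_on_pder.
- move=> g hf [f' Pf' ff'] hg [g' Pg' gg'].
  exists (fun q => f' q + g' q); first exact: alg_add.
  by move=> q Uq; rewrite (@pderD U) ?ff' ?gg'//; apply: P0.
- move=> g hf [f' Pf' ff'] hg [g' Pg' gg'].
  exists (fun q => f' q * g q + f q * g' q).
    by apply: alg_add; apply: alg_mul.
  by move=> q Uq; rewrite (@pderM U) ?ff' ?gg'//; apply: P0.
Qed.

Lemma smooth_onD U f g : open (U : set {ptws J -> R}) ->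
  smooth_on U f -> smooth_on U g -> smooth_on U (fun q => f q + g q).
Proof. by move=> oU hf hg; apply: alg_on_smooth => //; apply: alg_add; apply: alg_smooth. Qed.

Lemma smooth_onM U f g : open (U : set {ptws J -> R}) ->
  smooth_on U f -> smooth_on U g -> smooth_on U (fun q => f q * g q).
Proof. by move=> oU hf hg; apply: alg_on_smooth => //; apply: alg_mul; apply: alg_smooth. Qed.

Lemma smooth_on_cst U (a : R) : open (U : set {ptws J -> R}) ->
  smooth_on U (fun=> a).
Proof.
move=> oU; apply: (@smooth_on_ind (fun f => exists a, f = fun=> a)) => //.
- move=> _ [b ->] p _; split=> [c|]; [exact: derivable_cst|].
  move=> A /nbhs_singleton Ab; rewrite nbhs_filterE.
  exact: (@filterE _ _ (nbhs_filter (p : {ptws J -> R}))).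
- move=> _ c [b ->]; exists (fun=> 0); first by exists 0.
  by move=> q _; rewrite pder_cst.
- by exists a.
Qed.

Lemma smooth_on_coord U c : open (U : set {ptws J -> R}) ->
  smooth_on U (fun p => p c).
Proof.
move=> oU.
apply: (@smooth_on_ind (fun f => (f = fun p => p c) \/ exists a, f = fun=> a)) => //.
- move=> _ [->|[a ->]] p Up; last exact: smooth_on0 (smooth_on_cst a oU) _ _.
  split=> [d|]; last exact: ptws_coord_continuous.
  by rewrite /upd; case: eqP => _; [exact: derivable_id | exact: derivable_cst].
- move=> _ d [->|[a ->]].
    exists (fun=> (c == d)%:R); last by move=> q _; rewrite pder_coord.
    by right; exists (c == d)%:R.
  exists (fun=> 0); first by right; exists 0.
  by move=> q _; rewrite pder_cst.
- by left.
Qed.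

End Smooth.

(** * Symmetry of second partial derivatives *)

Section Schwarz.
Variables (R : realType) (J : eqType).
Implicit Types (p : J -> R) (c d : J) (f : (J -> R) -> R) (U : set (J -> R)).

Lemma dist_le_split (a b x y e : R) :
  x = y -> `|a - x| < e / 2 -> `|b - y| < e / 2 -> `|a - b| <= e.
Proof.
move=> <- ha hb; rewrite (_ : a - b = (a - x) - (b - x)); last by ring.
by rewrite (le_trans (ler_normB _ _))// [e]splitr ltW// ltrD.
Qed.

Lemma MVT_derivable (f df : R -> R) (a b : R) : a <= b ->
  (forall x, x \in `[a, b] -> is_derive x 1 f (df x)) ->
  exists2 x, x \in `[a, b] & f b - f a = df x * (b - a).
Proof.
move=> ab h; have hc : {within `[a, b], continuous f}.
  by apply: derivable_within_continuous => x xab; exact: (@ex_derive _ _ _ _ _ _ _ (h x xab)).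
have h' x : x \in `]a, b[ -> is_derive x 1 f (df x).
  by move=> xab; apply: h; exact: subset_itv_oo_cc.
exact: (@MVT_segment R f df a b ab h' hc).
Qed.

Lemma pder_is_derive2 U f p c d s t : c != d -> smooth_on U f ->
  U (upd (upd p c s) d t) ->
  is_derive s 1 (fun s => f (upd (upd p c s) d t)) (pder c f (upd (upd p c s) d t)).
Proof.
move=> cd hf Us.
have := pder_is_derive c (smooth_on0 hf) Us.
rewrite {1}(updC _ _ _ cd) upd_same.
rewrite (_ : (fun t0 => _) = (fun s => f (upd (upd p c s) d t)))//.
by apply/funext => s'; rewrite (updC p s' t cd) (updC p s t cd) upd_upd.
Qed.

(** The mean value theorem in the variable [c], applied to the increment of f in the variable [d],
    is followed by the mean value theorem in [d], applied to [pder c f]. *)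
Lemma second_difference U f p c d (x y h : R) : c != d -> smooth_on U f -> 0 <= h ->
  (forall s t, s \in `[x, x + h] -> t \in `[y, y + h] -> U (upd (upd p c s) d t)) ->
  exists s t, [/\ s \in `[x, x + h], t \in `[y, y + h] &
   f (upd (upd p c (x + h)) d (y + h)) - f (upd (upd p c x) d (y + h)) -
   (f (upd (upd p c (x + h)) d y) - f (upd (upd p c x) d y)) =
   pder d (pder c f) (upd (upd p c s) d t) * h * h].
Proof.
move=> cd hf h0 hU.
have xh : x <= x + h by rewrite lerDl.
have yh : y <= y + h by rewrite lerDl.
have y1 : y \in `[y, y + h] by rewrite in_itv /= lexx.
have y2 : y + h \in `[y, y + h] by rewrite in_itv /= lexx andbT.
have [s sI Es] := @MVT_derivable
  (fun s => f (upd (upd p c s) d (y + h)) - f (upd (upd p c s) d y))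
  (fun s => pder c f (upd (upd p c s) d (y + h)) - pder c f (upd (upd p c s) d y))
  _ _ xh (fun s sI => is_deriveB (pder_is_derive2 cd hf (hU s _ sI y2))
                                 (pder_is_derive2 cd hf (hU s _ sI y1))).
have [|t tI Et] := @MVT_derivable
  (fun t => pder c f (upd (upd p c s) d t))
  (fun t => pder d (pder c f) (upd (upd p c s) d t)) _ _ yh.
  move=> t tI; have := pder_is_derive d (smooth_on0 (smooth_on_pder c hf)) (hU s t sI tI).
  rewrite upd_same (_ : (fun t0 => _) = (fun t => pder c f (upd (upd p c s) d t)))//.
  by apply/funext => t'; rewrite upd_upd.
exists s, t; split=> //.
move: Es; rewrite Et !(addrC x) !(addrC y) !addrK => <-; ring.
Qed.

(** The second difference of f over a square with corner p does not depend on which variable is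
    increased first. It is h^2 times either mixed derivative, each taken at some point of the
    square, and both are continuous at p. *)
Lemma pderC U f p c d : open (U : set {ptws J -> R}) -> smooth_on U f -> U p ->
  pder c (pder d f) p = pder d (pder c f) p.
Proof.
move=> oU hf Up; have [->//|cd] := eqVneq c d.
apply/eqP; rewrite -subr_eq0 -normr_le0; apply/ler_addgt0Pr => e e0; rewrite add0r.
have e20 : 0 < e / 2 by rewrite divr_gt0.
pose A := pder c (pder d f); pose B := pder d (pder c f).
(* A square inside [W] keeps each mixed derivative within e/2 of its value at p, so a common value
   taken inside it bounds the difference at p by e. *)
pose W : set (J -> R) := [set q | [/\ U q, `|A p - A q| < e / 2 & `|B p - B q| < e / 2]].
have nW : nbhs (p : {ptws J -> R}) W.
  have FF := nbhs_filter (p : {ptws J -> R}).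
  have nU : nbhs (p : {ptws J -> R}) U by apply: open_nbhs_nbhs.
  have [_ /cvgrPdist_lt /(_ _ e20) cA] := smooth_on0 (smooth_on_pder c (smooth_on_pder d hf)) Up.
  have [_ /cvgrPdist_lt /(_ _ e20) cB] := smooth_on0 (smooth_on_pder d (smooth_on_pder c hf)) Up.
  have cAB := @filterI _ _ FF _ _ cA cB.
  have cW := @filterI _ _ FF _ _ nU cAB.
  have sW := @filterS _ _ FF _ W _ cW.
  apply: sW.
  move=> q [Uq [Aq Bq]].
  by split; [exact: Uq | exact: Aq | exact: Bq].
have := @upd2_continuous R J p c d (p c, p d) W.
rewrite /= !upd_id => /(_ nW).
rewrite nbhs_filterE /= => -[[V1 V2] /= [nV1 nV2] V12].
have /nbhs_ballP[r1 /= r10 b1] := nV1.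
have /nbhs_ballP[r2 /= r20 b2] := nV2.
have r0 : 0 < Num.min r1 r2 by rewrite lt_min r10.
have [h h0 hr] : exists2 h, 0 < h & h < Num.min r1 r2.
  by exists (Num.min r1 r2 / 2); rewrite ?divr_gt0// ltr_pdivrMr// ltr_pMr ?ltr1n.
have hW s t : s \in `[p c, p c + h] -> t \in `[p d, p d + h] -> W (upd (upd p c s) d t).
  rewrite !in_itv /= => /andP[s1 s2] /andP[t1 t2].
  move: hr; rewrite lt_min => /andP[hr1 hr2].
  apply: (V12 (s, t)); split=> /=.
    apply: b1; rewrite /ball /= distrC ger0_norm ?subr_ge0//.
    by rewrite (le_lt_trans _ hr1)// lerBlDl.
  apply: b2; rewrite /ball /= distrC ger0_norm ?subr_ge0//.
  by rewrite (le_lt_trans _ hr2)// lerBlDl.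
have [|s [t [sI tI E1]]] := @second_difference U f p c d (p c) (p d) h cd hf (ltW h0).
  by move=> s t sI tI; have [] := hW s t sI tI.
have [||t' [s' [tI' sI' E2]]] := @second_difference U f p d c (p d) (p c) h _ hf (ltW h0).
- by rewrite eq_sym.
- by move=> t' s' tI' sI'; rewrite -updC//; have [] := hW s' t' sI' tI'.
have [_ _ HB] := hW s t sI tI; have [_ HA _] := hW s' t' sI' tI'.
have E : A (upd (upd p c s') d t') = B (upd (upd p c s) d t).
  rewrite -!(updC _ _ _ cd) in E2.
  have hinj (a b : R) : a * h * h = b * h * h -> a = b.
    by move=> /eqP; rewrite -subr_eq0 -!mulrBl !mulf_eq0 (gt_eqF h0) !orbF subr_eq0 => /eqP.
  apply: hinj.
  refine (etrans (esym E2) (etrans _ E1)); ring.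
exact: (dist_le_split E HA HB).
Qed.

End Schwarz.

(** * Symmetric multi-indices, words, and the multinomial count *)

Section MultiIndices.
Variable n : nat.
Implicit Types (l k : 'I_n) (M : midx n) (s : seq 'I_n).

Lemma midxSE l M : midxS l M l = (M l).+1.
Proof. by rewrite ffunE eqxx. Qed.

Lemma mdeg0 : mdeg (midx0 n) = 0%N.
Proof. by rewrite /mdeg big1 // => i _; rewrite ffunE. Qed.

Lemma mdegS l M : mdeg (midxS l M) = (mdeg M).+1.
Proof.
rewrite /mdeg; under eq_bigr do rewrite ffunE; rewrite big_split /=.
by rewrite (bigD1 l)//= eqxx big1 ?addn0 ?add1n// => i /negbTE ->.
Qed.

Lemma mdeg_eq0 M : mdeg M = 0%N -> M = midx0 n.
Proof.
move=> /eqP; rewrite /mdeg sum_nat_eq0 => /forallP h.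
by apply/ffunP => i; rewrite ffunE; apply/eqP; have := h i.
Qed.

Lemma midxSC l k M : midxS l (midxS k M) = midxS k (midxS l M).
Proof. by apply/ffunP => i; rewrite !ffunE addnCA. Qed.

Lemma midxS_inj l : injective (midxS l).
Proof. by move=> M M' /ffunP h; apply/ffunP => i; have := h i; rewrite !ffunE => /addnI. Qed.

Lemma midx_of_nil : midx_of [::] = midx0 n.
Proof. by apply/ffunP => i; rewrite !ffunE. Qed.

Lemma midx_of_cons l s : midx_of (l :: s) = midxS l (midx_of s).
Proof. by apply/ffunP => i; rewrite !ffunE /= eq_sym. Qed.

Lemma mdeg_midx_of s : mdeg (midx_of s) = size s.
Proof. by elim: s => [|l s IH]; rewrite ?midx_of_nil ?mdeg0// midx_of_cons mdegS IH. Qed.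

(** The entries of a multi-index of degree at most N are themselves at most N, so functions into
    ['I_N.+1] reach all of them. *)
Definition midxs N : seq (midx n) :=
  [seq M <- [seq [ffun i => val (g i)] | g : {ffun 'I_n -> 'I_N.+1}] | (mdeg M <= N)%N].

Lemma midxs_uniq N : uniq (midxs N).
Proof.
apply: filter_uniq; rewrite map_inj_uniq ?enum_uniq//.
move=> f g /ffunP h; apply/ffunP => i; apply: val_inj.
by have := h i; rewrite !ffunE.
Qed.

Lemma mem_midxs N M : (M \in midxs N) = (mdeg M <= N)%N.
Proof.
rewrite mem_filter andb_idr// => MN.
apply/mapP; exists [ffun i => inord (M i)]; first by rewrite mem_enum.
apply/ffunP => i; rewrite !ffunE /= inordK// ltnS (leq_trans _ MN)//.
by rewrite /mdeg (bigD1 i)//= leq_addr.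
Qed.

Lemma big_midxs_shift (V : nmodType) N l (F : midx n -> V) :
  \sum_(M <- midxs N) F (midxS l M) = \sum_(M <- midxs N.+1 | (0 < M l)%N) F M.
Proof.
rewrite -(big_map (midxS l) xpredT F) -[RHS]big_filter; apply: perm_big.
apply: uniq_perm; [by rewrite map_inj_uniq ?midxs_uniq//; exact: midxS_inj| |].
  by apply: filter_uniq; exact: midxs_uniq.
move=> M; rewrite mem_filter mem_midxs; apply/mapP/idP.
  move=> [M' + ->]; rewrite mem_midxs => h.
  by rewrite mdegS ltnS h midxSE.
move=> /andP[Ml MN].
have EM : M = midxS l [ffun i => (M i - (i == l))%N].
  apply/ffunP => i; rewrite !ffunE; case: eqP => [->|_]; last by rewrite subn0.
  by rewrite subnKC.
by exists [ffun i => (M i - (i == l))%N] => //; rewrite mem_midxs -ltnS -(mdegS l) -EM.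
Qed.

Lemma big_midxs_pick (V : nmodType) N M0 (F : midx n -> V) : (mdeg M0 <= N)%N ->
  (forall M, M != M0 -> F M = 0) ->
  \sum_(M <- midxs N) F M = F M0.
Proof.
move=> h F0; rewrite (bigD1_seq M0) ?mem_midxs ?midxs_uniq//= big1 ?addr0//.
Qed.

Fixpoint words j : seq (seq 'I_n) :=
  if j is j'.+1 then [seq l :: s | l <- enum 'I_n, s <- words j'] else [:: [::]].

Lemma mem_words j s : (s \in words j) = (size s == j).
Proof.
elim: j s => [|j IH] [|l s] //=.
  by apply/negbTE/allpairsP => -[[? ?] []].
rewrite eqSS -IH; apply/allpairsP/idP; first by move=> [[l' s'] /= [_ h [_ ->]]].
by move=> h; exists (l, s); rewrite mem_enum.
Qed.

Lemma words_uniq j : uniq (words j).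
Proof.
elim: j => //= j IH; apply: allpairs_uniq => //; first exact: enum_uniq.
by move=> [l s] [l' s'] _ _ /= [-> ->].
Qed.

Definition mfact M : nat := (\prod_i (M i)`!)%N.

Lemma mfact0 : mfact (midx0 n) = 1%N.
Proof. by rewrite /mfact big1// => i _; rewrite ffunE. Qed.

Lemma mfactS l M : mfact (midxS l M) = ((M l).+1 * mfact M)%N.
Proof.
rewrite /mfact (bigD1 l)//= [in RHS](bigD1 l)//= midxSE factS mulnA.
by congr muln; apply: eq_bigr => i /negbTE il; rewrite ffunE il.
Qed.

Variable R : realType.

(* The multinomial count of the orderings of a multi-index, as a recursion that
   strips the first letter of each word. *)
Lemma sum_words_deg N j (X : midx n -> R) : (j <= N)%N ->
  \sum_(s <- words j) (mfact (midx_of s))%:R / (size s)`!%:R * X (midx_of s) =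
  \sum_(M <- midxs N | mdeg M == j) X M.
Proof.
elim: j N X => [|j IH] N X jN /=.
  rewrite big_seq1 /= midx_of_nil mfact0 divr1 mul1r.
  rewrite big_mkcond (@big_midxs_pick _ N (midx0 n)) ?mdeg0 ?eqxx//.
  by move=> M M0; case: eqP => // /mdeg_eq0 ME; rewrite ME eqxx in M0.
case: N jN => // N jN.
rewrite big_allpairs_dep /=.
transitivity (\sum_(l <- enum 'I_n) \sum_(M <- midxs N.+1 | mdeg M == j.+1)
    (M l)%:R / j.+1%:R * X M).
  apply: eq_bigr => l _.
  transitivity (\sum_(s <- words j) (mfact (midx_of s))%:R / (size s)`!%:R *
     (((midxS l (midx_of s)) l)%:R / j.+1%:R * X (midxS l (midx_of s)))).
    rewrite !big_seq; apply: eq_bigr => s; rewrite mem_words => /eqP sj.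
    rewrite /= sj midx_of_cons mfactS factS !natrM midxSE mulrA; congr (_ * _).
    by field; rewrite nat1r !pnatr_eq0 /= -lt0n fact_gt0.
  have /= -> := IH N (fun M => (midxS l M l)%:R / j.+1%:R * X (midxS l M)) jN.
  pose F M := if mdeg M == j.+1 then (M l)%:R / j.+1%:R * X M else 0 : R.
  rewrite big_mkcond /= (eq_bigr (fun M => F (midxS l M))); last first.
    by move=> M _; rewrite /F mdegS eqSS.
  rewrite big_midxs_shift /F.
  rewrite big_mkcond [RHS]big_mkcond /=; apply: eq_bigr => M _.
  by case: (M l) => //=; rewrite mul0r mul0r; case: ifP.
(* The fractions [(M l)%:R / j.+1%:R] contributed by the first letters add up to 1, because the
   entries of M add up to its degree j + 1. *)
rewrite exchange_big /=; apply: eq_bigr => M /eqP Mj.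
by rewrite -!mulr_suml big_enum /= -natr_sum -/(mdeg M) Mj divff ?pnatr_eq0// mul1r.
Qed.

(** The weight is the share that [coef] gives to each ordering of a multi-index, so the orderings of
    M together contribute X M once. The vanishing of X beyond degree N makes the sum over all tuples
    finitely supported. *)
Lemma fsum_words N (X : midx n -> R) : (forall M, (N < mdeg M)%N -> X M = 0) ->
  \sum_(s \in [set: seq 'I_n]) (mfact (midx_of s))%:R / (size s)`!%:R * X (midx_of s) =
  \sum_(M <- midxs N) X M.
Proof.
move=> X0.
pose ws := flatten [seq words j | j <- iota 0 N.+1].
have mem_ws s : (s \in ws) = (size s <= N)%N.
  apply/flatten_mapP/idP => [[j]|sN].
    by rewrite mem_iota mem_words => /andP[_ h] /eqP ->.
  by exists (size s); rewrite ?mem_iota ?mem_words//.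
have ws_uniq : uniq ws.
  rewrite /ws; elim: (iota 0 N.+1) (iota_uniq 0 N.+1) => //= j js IH /andP[jj uj].
  rewrite cat_uniq words_uniq IH// andbT /=; apply/hasPn => s /flatten_mapP[k kj].
  rewrite !mem_words => /eqP ->; apply/eqP => kjE; move: jj.
  by rewrite -kjE kj.
rewrite (fsbigE ws)//; last first.
  by move=> s _; rewrite mem_ws -ltnNge -mdeg_midx_of => /X0 ->; rewrite mulr0.
rewrite (eq_bigl xpredT); last by move=> s; rewrite in_setT.
rewrite big_flatten big_map.
rewrite (eq_big_seq (fun j => \sum_(M <- midxs N | mdeg M == j) X M)); last first.
  by move=> j; rewrite mem_iota add0n ltnS => /andP[_ jN]; rewrite (sum_words_deg _ jN).
rewrite (exchange_big_dep xpredT)// big_seq [RHS]big_seq; apply: eq_bigr => M.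
rewrite mem_midxs => MN; rewrite big_mkcond (bigD1_seq (mdeg M)) ?iota_uniq//; last first.
  by rewrite mem_iota add0n ltnS MN.
by rewrite /= eqxx big1 ?addr0// => j /negbTE; rewrite eq_sym => ->.
Qed.

End MultiIndices.

(** * Composition with maps that select or freeze coordinates *)

Section Reindexing.
Variables (R : realType) (J J' : eqType) (sg : J -> option J') (v : J -> R).
Hypothesis sg_inj : forall c d j, sg c = Some j -> sg d = Some j -> c = d.

(** A common form for [jbase], [jproj] and [jlift]: a coordinate sent to [None] is frozen at its
    value in [v]. By [sg_inj] each source coordinate feeds at most one target coordinate, so the
    chain rule has at most one term. *)
Definition reindex (p : J' -> R) : J -> R :=
  fun c => if sg c is Some j then p j else v c.

Lemma reindex_continuous (p : {ptws J' -> R}) :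
  {for p, continuous (reindex : {ptws J' -> R} -> {ptws J -> R})}.
Proof.
apply: ptws_continuous_at => c; rewrite /reindex; case: (sg c) => [j|].
  exact: ptws_coord_continuous.
exact: (@cst_continuous {ptws J' -> R} R (v c) p).
Qed.

Lemma reindex_open (U : set {ptws J -> R}) : open U ->
  open ([set p | U (reindex p)] : set {ptws J' -> R}).
Proof.
move=> oU; apply: open_comp oU => p _; exact: reindex_continuous.
Qed.

Lemma reindex_upd p c j t : sg c = Some j ->
  reindex (upd p j t) = upd (reindex p) c t.
Proof.
move=> cj; apply/funext => d; rewrite /reindex /upd.
case: (d =P c) => [->|dc]; first by rewrite cj eqxx.
by case E: (sg d) => [i|//]; case: eqP => // ij; case: dc; apply: sg_inj cj; rewrite E ij.
Qed.

Lemma reindex_upd_out p j t : ~ (exists c, sg c = Some j) ->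
  reindex (upd p j t) = reindex p.
Proof.
move=> nj; apply/funext => d; rewrite /reindex /upd.
by case E: (sg d) => [i|//]; case: eqP => // ij; case: nj; exists d; rewrite E ij.
Qed.

Lemma pder_reindex f p c j : sg c = Some j ->
  pder j (fun q => f (reindex q)) p = pder c f (reindex p).
Proof.
move=> cj; rewrite /pder; have -> : reindex p c = p j by rewrite /reindex cj.
by under eq_fun => t do rewrite (reindex_upd _ _ cj).
Qed.

Lemma pder_reindex_out f p j : ~ (exists c, sg c = Some j) ->
  pder j (fun q => f (reindex q)) p = 0.
Proof.
move=> nj; rewrite /pder.
by under eq_fun => t do rewrite (reindex_upd_out _ _ nj); rewrite derive1_cst.
Qed.

(** The composites with [reindex] form a class to which [smooth_on_ind] applies: a partial
    derivative of a composite is again a composite, or zero in a direction that feeds no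
    coordinate. *)
Lemma smooth_on_reindex (U : set (J -> R)) f : open (U : set {ptws J -> R}) ->
  smooth_on U f -> smooth_on [set p | U (reindex p)] (fun p => f (reindex p)).
Proof.
move=> oU hf; have oU' := reindex_open oU.
apply: (@smooth_on_ind R J' (fun g' => exists2 g, smooth_on U g &
   g' = fun p => g (reindex p)) [set p | U (reindex p)]) => //.
- move=> _ [g hg ->] p Up; have [g1 g2] := smooth_on0 hg Up; split=> [j|].
    have [[c cj]|nj] := pselect (exists c, sg c = Some j).
      rewrite (_ : (fun t => _) = fun t => g (upd (reindex p) c t)).
        by have := g1 c; rewrite {2}/reindex cj.
      by apply/funext => t; rewrite (reindex_upd _ _ cj).
    rewrite (_ : (fun t => _) = fun t => g (reindex p)); first exact: derivable_cst.
    by apply/funext => t; rewrite (reindex_upd_out _ _ nj).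
  by move=> A /g2 hA; exact: (reindex_continuous hA).
- move=> _ j [g hg ->].
  have [[c cj]|nj] := pselect (exists c, sg c = Some j).
    exists (fun p => pder c g (reindex p)).
      by exists (pder c g) => //; exact: smooth_on_pder.
    by move=> q _; rewrite (pder_reindex _ _ cj).
  exists (fun=> 0); last by move=> q _; rewrite (pder_reindex_out _ _ nj).
  by exists (fun=> 0) => //; exact: smooth_on_cst.
- by exists f.
Qed.

End Reindexing.

(** * The ring of smooth functions of finite order over a domain of jets *)

Section JetFunctions.
Variables (R : realType) (n : nat).

(** [jset_order] says that only the coordinates of order zero are restricted. A coordinate of
    positive order moves freely inside the domain, so derivatives beyond the order of a function
    vanish. *)
Record jopen (K : finType) := JOpen {
  jset :> set (jidx n K -> R);
  jset_open : open (jset : set {ptws (jidx n K) -> R});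
  jset_order : forall p q, (forall c, jorder c = 0%N -> p c = q c) ->
    jset p -> jset q }.

Variables (K : finType) (Om : jopen K).
Local Notation J := (jidx n K).

(** [jfun_out] fixes the irrelevant values, so that agreement on the domain is equality and the ring
    laws hold literally. *)
Record jfun := JFun {
  jev :> (J -> R) -> R;
  jfun_smooth : smooth_on Om jev;
  jfun_order : exists k, order_le k Om jev;
  jfun_out : forall p, ~ jset Om p -> jev p = 0 }.

Implicit Types (f g : jfun) (p : J -> R) (c : J).

Lemma jfun_eq f g : (forall p, jset Om p -> f p = g p) -> f = g.
Proof.
case: f g => [f f1 f2 f3] [g g1 g2 g3] /= fg.
have E : f = g.
  by apply/funext => p; have [/fg//|np] := pselect (jset Om p); rewrite f3// g3.
subst g; congr JFun; exact: Prop_irrelevance.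
Qed.

Lemma order_le_eq k h h' : (forall p, jset Om p -> h p = h' p) ->
  order_le k Om h -> order_le k Om h'.
Proof. by move=> E hk p q Up Uq pq; rewrite -!E//; apply: hk. Qed.

Lemma order_le_widen k k' h : (k <= k')%N -> order_le k Om h -> order_le k' Om h.
Proof.
move=> kk hk p q Up Uq pq; apply: hk => // c ck; apply: pq.
exact: leq_trans ck kk.
Qed.

Lemma jfun_of_proof h : smooth_on Om h -> (exists k, order_le k Om h) ->
  {g : jfun | forall p, jset Om p -> g p = h p}.
Proof.
move=> hs ho; pose h' p := if pselect (jset Om p) then h p else 0.
have E p : jset Om p -> h p = h' p by rewrite /h'; case: pselect.
have s' : smooth_on Om h' by apply: smooth_on_eq hs => //; exact: jset_open.
have o' : exists k, order_le k Om h'.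
  by case: ho => k hk; exists k; exact: order_le_eq hk.
have z' p : ~ jset Om p -> h' p = 0 by rewrite /h'; case: pselect.
by exists (JFun s' o' z') => p /E.
Qed.

Definition jfun_of h (hs : smooth_on Om h) (ho : exists k, order_le k Om h) : jfun :=
  sval (jfun_of_proof hs ho).

Lemma jfun_ofE h hs ho p : jset Om p -> @jfun_of h hs ho p = h p.
Proof. exact: (svalP (jfun_of_proof hs ho)). Qed.

Lemma order_le_op2 (op : R -> R -> R) f g :
  exists k, order_le k Om (fun p => op (f p) (g p)).
Proof.
have [k fk] := jfun_order f; have [k' gk] := jfun_order g.
exists (maxn k k') => p q Up Uq pq.
have {}fk := order_le_widen (leq_maxl k k') fk.
have {}gk := order_le_widen (leq_maxr k k') gk.
by rewrite (fk p q)// (gk p q).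
Qed.

Lemma order_le_cst (a : R) : exists k, order_le k Om (fun=> a).
Proof. by exists 0%N. Qed.

Definition jcst (a : R) : jfun :=
  jfun_of (smooth_on_cst a (jset_open Om)) (order_le_cst a).

Definition jadd f g : jfun := jfun_of
  (smooth_onD (jset_open Om) (jfun_smooth f) (jfun_smooth g)) (order_le_op2 +%R f g).

Definition jmul f g : jfun := jfun_of
  (smooth_onM (jset_open Om) (jfun_smooth f) (jfun_smooth g)) (order_le_op2 *%R f g).

Definition jopp f : jfun := jmul (jcst (-1)) f.

Lemma jcstE a p : jset Om p -> jcst a p = a.
Proof. exact: jfun_ofE. Qed.

Lemma jaddE f g p : jset Om p -> jadd f g p = f p + g p.
Proof. exact: jfun_ofE. Qed.

Lemma jmulE f g p : jset Om p -> jmul f g p = f p * g p.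
Proof. exact: jfun_ofE. Qed.

Lemma jaddA : associative jadd.
Proof. by move=> f g h; apply: jfun_eq => p Up; rewrite !jaddE// addrA. Qed.

Lemma jaddC : commutative jadd.
Proof. by move=> f g; apply: jfun_eq => p Up; rewrite !jaddE// addrC. Qed.

Lemma jadd0 : left_id (jcst 0) jadd.
Proof. by move=> f; apply: jfun_eq => p Up; rewrite jaddE// jcstE// add0r. Qed.

Lemma jaddN : left_inverse (jcst 0) jopp jadd.
Proof.
by move=> f; apply: jfun_eq => p Up; rewrite jaddE// jmulE// !jcstE// mulN1r addNr.
Qed.

Lemma jmulA : associative jmul.
Proof. by move=> f g h; apply: jfun_eq => p Up; rewrite !jmulE// mulrA. Qed.

Lemma jmulC : commutative jmul.
Proof. by move=> f g; apply: jfun_eq => p Up; rewrite !jmulE// mulrC. Qed.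

Lemma jmul1 : left_id (jcst 1) jmul.
Proof. by move=> f; apply: jfun_eq => p Up; rewrite jmulE// jcstE// mul1r. Qed.

Lemma jmulDl : left_distributive jmul jadd.
Proof. by move=> f g h; apply: jfun_eq => p Up; rewrite !(jmulE,jaddE)// mulrDl. Qed.

HB.instance Definition _ := gen_eqMixin jfun.
HB.instance Definition _ := gen_choiceMixin jfun.
HB.instance Definition _ := GRing.isZmodule.Build jfun jaddA jaddC jadd0 jaddN.
HB.instance Definition _ :=
  GRing.Zmodule_isComPzRing.Build jfun jmulA jmulC jmul1 jmulDl.

Lemma jev0 p : (0 : jfun) p = 0.
Proof. by have [Up|/jfun_out//] := pselect (jset Om p); rewrite jcstE. Qed.

Lemma jevD f g p : (f + g) p = f p + g p.
Proof.
have [Up|np] := pselect (jset Om p); first exact: jaddE.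
by rewrite !jfun_out ?addr0.
Qed.

Lemma jevM f g p : (f * g) p = f p * g p.
Proof.
have [Up|np] := pselect (jset Om p); first exact: jmulE.
by rewrite !jfun_out ?mulr0.
Qed.

Lemma jevN f p : (- f) p = - f p.
Proof. by apply: (addrI (f p)); rewrite -jevD !subrr jev0. Qed.

Lemma jev_sign j f p : ((-1) ^+ j * f) p = (-1) ^+ j * f p.
Proof.
rewrite -signr_odd -[in RHS]signr_odd !mulr_sign.
by case: (odd j); rewrite ?jevN.
Qed.

Lemma jev_sum (I : Type) (r : seq I) (P : pred I) (F : I -> jfun) p :
  (\sum_(i <- r | P i) F i) p = \sum_(i <- r | P i) F i p.
Proof.
elim/big_rec2: _ => [|i x y _ <-]; first exact: jev0.
exact: jevD.
Qed.

End JetFunctions.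

(** * Partial derivatives as commuting derivations of this ring *)

Section JetDerivations.
Variables (R : realType) (n : nat) (K : finType) (Om : jopen R n K).
Local Notation J := (jidx n K).
Local Notation jfun := (jfun Om).
Implicit Types (f g : jfun) (p : J -> R) (c : J) (l : 'I_n).

Lemma jset_upd p c t : (0 < jorder c)%N -> jset Om p -> jset Om (upd p c t).
Proof.
move=> c0; apply: jset_order => d d0; rewrite upd_neq//.
by apply: contraTneq c0 => <-; rewrite d0.
Qed.

(** The derivative is taken at the value of the coordinate [c], so the two points must agree there
    too; this is the source of the maximum with [jorder c]. *)
Lemma order_le_pder k c (h : (J -> R) -> R) :
  order_le k Om h -> order_le (maxn k (jorder c)) Om (pder c h).
Proof.
move=> hk p q Up Uq pq; rewrite /pder !derive1E -(pq c) ?leq_maxr//.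
apply: near_eq_derive.
have nq : \forall t \near p c, jset Om (upd q c t).
  by rewrite (pq c) ?leq_maxr//; exact: (near_upd c (jset_open Om) Uq).
have np := near_upd c (jset_open Om) Up.
apply: filterS2 np nq => t tp tq; apply: hk => // d dk.
rewrite /upd; case: ifP => // _; apply: pq.
exact: leq_trans dk (leq_maxl _ _).
Qed.

Lemma pder_order k c (h : (J -> R) -> R) p :
  order_le k Om h -> (k < jorder c)%N -> jset Om p -> pder c h p = 0.
Proof.
move=> hk ck Up; rewrite /pder (_ : (fun t => _) = fun t => h p) ?derive1_cst//.
apply/funext => t; apply: hk => //.
  by apply: jset_upd => //; exact: leq_ltn_trans ck.
by move=> d dk; rewrite upd_neq//; apply: contraTneq ck => <-; rewrite -leqNgt.
Qed.

Lemma jder_order c f : exists k, order_le k Om (pder c f).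
Proof.
have [k hk] := jfun_order f; exists (maxn k (jorder c)); exact: order_le_pder.
Qed.

Definition jder c f : jfun := jfun_of (smooth_on_pder c (jfun_smooth f)) (jder_order c f).

Lemma jcoord_order c : exists k, order_le k Om (fun p => p c).
Proof. by exists (jorder c) => p q _ _; apply. Qed.

Definition jcoord c : jfun := jfun_of (smooth_on_coord c (jset_open Om)) (jcoord_order c).

Lemma jderE c f p : jset Om p -> jder c f p = pder c f p.
Proof. exact: jfun_ofE. Qed.

Lemma jcoordE c p : jset Om p -> jcoord c p = p c.
Proof. exact: jfun_ofE. Qed.

Lemma pder_ev c f (h : (J -> R) -> R) p : (forall q, jset Om q -> h q = f q) ->
  jset Om p -> pder c h p = jder c f p.
Proof.
move=> hf Up; rewrite jderE//.
exact: (pder_eq c (jset_open Om) hf Up).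
Qed.

Lemma jderD c f g : jder c (f + g) = jder c f + jder c g.
Proof.
apply: jfun_eq => p Up.
rewrite -(@pder_ev c _ (fun q => f q + g q)) => [|q _|]; rewrite ?jevD//.
rewrite !jderE//.
exact: (pderD c (smooth_on0 (jfun_smooth f)) (smooth_on0 (jfun_smooth g)) Up).
Qed.

Lemma jder0 c : jder c 0 = 0.
Proof. by apply: (addrI (jder c 0)); rewrite -jderD !addr0. Qed.

Lemma jderM c f g : jder c (f * g) = jder c f * g + f * jder c g.
Proof.
apply: jfun_eq => p Up.
rewrite -(@pder_ev c _ (fun q => f q * g q)) => [|q _|]; rewrite ?jevD ?jevM//.
rewrite !jderE//.
exact: (pderM c (smooth_on0 (jfun_smooth f)) (smooth_on0 (jfun_smooth g)) Up).
Qed.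

Lemma jder2E c d f p : jset Om p -> jder c (jder d f) p = pder c (pder d f) p.
Proof.
move=> Up; apply/esym.
by apply: (@pder_ev c (jder d f) (pder d f)) => // q Uq; rewrite jderE.
Qed.

Lemma jderC c d f : jder c (jder d f) = jder d (jder c f).
Proof.
apply: jfun_eq => p Up; rewrite (jder2E c d f Up) (jder2E d c f Up).
exact: (pderC c d (jset_open Om) (jfun_smooth f) Up).
Qed.

Lemma jder_cst c a : jder c (jcst Om a) = 0.
Proof.
apply: jfun_eq => p Up; rewrite jev0.
rewrite -(@pder_ev c _ (fun=> a)) => [|q Uq|]//; last by rewrite jcstE.
exact: pder_cst.
Qed.

Lemma jder_coord c d : jder c (jcoord d) = (d == c)%:R.
Proof.
apply: jfun_eq => p Up.
rewrite -(@pder_ev c _ (fun q => q d)) => [|q Uq|]//; last by rewrite jcoordE.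
rewrite pder_coord; case: (d == c); last by rewrite jev0.
by rewrite [in RHS]/GRing.one /= jcstE.
Qed.

HB.instance Definition _ c := GRing.isNmodMorphism.Build jfun jfun (jder c)
  (conj (jder0 c) (jderD c)).

End JetDerivations.

(** * Total derivatives as commuting derivations *)

Section TotalDerivatives.
Variables (R : realType) (n : nat) (K : finType) (Om : jopen R n K).
Local Notation J := (jidx n K).
Local Notation jfun := (jfun Om).
Implicit Types (f g : jfun) (p : J -> R) (c : K * midx n) (l k : 'I_n) (M : midx n).

Definition jshift l c : K * midx n := (c.1, midxS l c.2).

Definition jidxs N : seq (K * midx n) := [seq (a, M) | a <- enum K, M <- midxs n N].

Lemma jidxs_uniq N : uniq (jidxs N).
Proof.
apply: allpairs_uniq; [exact: enum_uniq | exact: midxs_uniq|].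
by move=> [a M] [b M'] _ _ [-> ->].
Qed.

Lemma mem_jidxs N c : (c \in jidxs N) = (mdeg c.2 <= N)%N.
Proof.
apply/allpairsP/idP => [[[a M]] [_ + ->]|h]; first by rewrite mem_midxs.
by exists c; rewrite mem_enum mem_midxs; case: c h.
Qed.

Lemma jder_order0 N f (d : J) : order_le N Om f -> (N < jorder d)%N -> jder d f = 0.
Proof.
by move=> hN dN; apply: jfun_eq => p Up; rewrite jderE// (pder_order hN dN Up) jev0.
Qed.

Definition jord f : nat := sval (cid (jfun_order f)).

Lemma jordP f : order_le (jord f) Om f.
Proof. exact: (svalP (cid (jfun_order f))). Qed.

(** A finite truncation of the sum in [tder]. Any N that bounds the order of f gives the full total
    derivative, and [jtd] uses one chosen bound. *)
Definition jtd_upto N l f : jfun :=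
  jder (inl l) f + \sum_(c <- jidxs N) jcoord Om (inr (jshift l c)) * jder (inr c) f.

Definition jtd l f : jfun := jtd_upto (jord f) l f.

Lemma jtd_upto_widen N N' l f : order_le N Om f -> (N <= N')%N ->
  jtd_upto N' l f = jtd_upto N l f.
Proof.
move=> hN NN; rewrite /jtd_upto; congr (_ + _).
rewrite [LHS](bigID (mem (jidxs N))) /= [X in _ + X]big1 ?addr0; last first.
  move=> c; rewrite mem_jidxs -ltnNge => cN.
  by rewrite (jder_order0 hN)// mulr0.
rewrite -[LHS]big_filter; apply: perm_big; apply: uniq_perm.
- exact/filter_uniq/jidxs_uniq.
- exact: jidxs_uniq.
- move=> c; rewrite mem_filter andb_idr// => h; rewrite mem_jidxs.
  by apply: leq_trans NN; rewrite -mem_jidxs.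
Qed.

(** Both truncations agree with the one at the larger of the two bounds. The freedom in N lets
    several functions be expanded over the same index set. *)
Lemma jtdE N l f : order_le N Om f ->
  jtd l f = jder (inl l) f + \sum_(c <- jidxs N) jcoord Om (inr (jshift l c)) * jder (inr c) f.
Proof.
move=> hN; rewrite -/(jtd_upto N l f) /jtd.
rewrite -(jtd_upto_widen l (@jordP f) (leq_maxl _ N)).
by rewrite -(jtd_upto_widen l hN (leq_maxr (jord f) N)).
Qed.

Lemma tder_ev l f (h : (J -> R) -> R) p : (forall q, jset Om q -> h q = f q) ->
  jset Om p -> tder l h p = jtd l f p.
Proof.
move=> hf Up; rewrite (jtdE l (@jordP f)) jevD jev_sum /tder (pder_ev _ hf Up); congr (_ + _).
rewrite (fsbigE (jidxs (jord f))); first last.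
- move=> c _; rewrite mem_jidxs -ltnNge => cN.
  by rewrite (pder_ev _ hf Up) (@jder_order0 _ f (inr c) (@jordP f) cN) jev0 mulr0.
- by [].
- exact: jidxs_uniq.
rewrite (eq_bigl xpredT); last by move=> c; rewrite in_setT.
by apply: eq_bigr => c _; rewrite jevM jcoordE// (pder_ev _ hf Up).
Qed.

Lemma jtdD l f g : jtd l (f + g) = jtd l f + jtd l g.
Proof.
have hf := order_le_widen (leq_maxl (jord f) (jord g)) (@jordP f).
have hg := order_le_widen (leq_maxr (jord f) (jord g)) (@jordP g).
rewrite (jtdE l hf) (jtdE l hg) (@jtdE (maxn (jord f) (jord g))); last first.
  by move=> p q Up Uq pq; rewrite !jevD (hf p q)// (hg p q).
rewrite raddfD addrACA -big_split; congr (_ + _) => /=.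
by apply: eq_bigr => c _; rewrite raddfD mulrDr.
Qed.

Lemma jtd0 l : jtd l 0 = 0.
Proof. by apply: (addrI (jtd l 0)); rewrite -jtdD !addr0. Qed.

HB.instance Definition _ l := GRing.isNmodMorphism.Build jfun jfun (jtd l)
  (conj (jtd0 l) (jtdD l)).

Lemma jtdM l f g : jtd l (f * g) = jtd l f * g + f * jtd l g.
Proof.
have hf := order_le_widen (leq_maxl (jord f) (jord g)) (@jordP f).
have hg := order_le_widen (leq_maxr (jord f) (jord g)) (@jordP g).
rewrite (jtdE l hf) (jtdE l hg) (@jtdE (maxn (jord f) (jord g))); last first.
  by move=> p q Up Uq pq; rewrite !jevM (hf p q)// (hg p q).
rewrite jderM mulrDl mulrDr addrACA mulr_suml mulr_sumr -big_split; congr (_ + _) => /=.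
by apply: eq_bigr => c _; rewrite jderM; ring.
Qed.

Lemma jtd_cst l (a : R) : jtd l (jcst Om a) = 0.
Proof.
rewrite (@jtdE 0%N); last by move=> p q Up Uq _; rewrite !jcstE.
by rewrite jder_cst big1 ?addr0// => c _; rewrite jder_cst mulr0.
Qed.

Lemma jtd_coord l c : jtd l (jcoord Om (inr c)) = jcoord Om (inr (jshift l c)).
Proof.
rewrite (@jtdE (mdeg c.2)); last first.
  by move=> p q Up Uq pq; rewrite !jcoordE// pq.
rewrite jder_coord add0r (bigD1_seq c) ?jidxs_uniq ?mem_jidxs//=.
rewrite jder_coord eqxx mulr1 big1 ?addr0// => d dc.
rewrite jder_coord (_ : (inr c == inr d) = false) ?mulr0//.
by apply/negbTE; apply: contraNneq dc => -[->].
Qed.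

Lemma jtd_jder N l f (d : J) : order_le N Om f -> (jorder d <= N)%N ->
  jtd l (jder d f) = jder (inl l) (jder d f) +
    \sum_(c <- jidxs N) jcoord Om (inr (jshift l c)) * jder (inr c) (jder d f).
Proof.
move=> hN dN; apply: jtdE => p q Up Uq pq; rewrite !jderE//.
by apply: (order_le_pder hN) => // c; rewrite (maxn_idPl dN); exact: pq.
Qed.

Lemma jshiftC l k c : jshift l (jshift k c) = jshift k (jshift l c).
Proof. by rewrite /jshift /= midxSC. Qed.

(** Expanding both total derivatives leaves four groups, each symmetric in l and k: the pure second
    derivative, the two mixed sums, which trade places, the terms where l differentiates a jet
    coordinate, and the double sum, where the summation indices are exchanged. Since f has order at
    most N, so have its derivatives in directions of order at most N, and one truncation serves
    throughout. *)
Lemma jtdC l k f : jtd l (jtd k f) = jtd k (jtd l f).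
Proof.
have hN := @jordP f; set N := jord f in hN.
pose y c := jcoord Om (inr c).
have E l' k' : jtd l' (jtd k' f) = jder (inl l') (jder (inl k') f) +
    (\sum_(c <- jidxs N) y (jshift l' c) * jder (inr c) (jder (inl k') f) +
     \sum_(c <- jidxs N) y (jshift k' c) * jder (inr c) (jder (inl l') f)) +
    \sum_(c <- jidxs N) y (jshift l' (jshift k' c)) * jder (inr c) f +
    \sum_(c <- jidxs N) \sum_(d <- jidxs N)
      y (jshift k' c) * y (jshift l' d) * jder (inr d) (jder (inr c) f).
  rewrite [jtd k' f](jtdE k' hN) raddfD /= (jtd_jder l' hN)// raddf_sum /=.
  rewrite -!addrA; refine (f_equal2 +%R erefl (f_equal2 +%R erefl _)).
  rewrite -!big_split /= !big_seq; apply: eq_bigr => c; rewrite mem_jidxs => cN.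
  rewrite jtdM jtd_coord (jtd_jder l' hN)// mulrDr mulr_sumr (jderC (inl l')).
  rewrite addrCA; congr (_ + (_ + _)).
  by apply: eq_bigr => d _; rewrite mulrA.
rewrite (E l k) (E k l).
refine (f_equal2 +%R (f_equal2 +%R (f_equal2 +%R _ _) _) _).
- exact: jderC.
- exact: addrC.
- by apply: eq_bigr => c _; rewrite jshiftC.
- rewrite exchange_big; apply: eq_bigr => c _; apply: eq_bigr => d _.
  by rewrite jderC [y _ * y _]mulrC.
Qed.

(** The directions are taken in a fixed order; by [jtdC], every word with multi-index M gives the
    same operator. *)
Definition jtdm M f : jfun := foldr (fun l g => iter (M l) (jtd l) g) f (enum 'I_n).

Lemma jtd_iter l k j f : jtd l (iter j (jtd k) f) = iter j (jtd k) (jtd l f).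
Proof. by elim: j => //= j <-; rewrite jtdC. Qed.

Lemma jtdmS l M f : jtdm (midxS l M) f = jtd l (jtdm M f).
Proof.
pose F (M' : midx n) r := foldr (fun l g => iter (M' l) (jtd l) g) f r.
(* For a duplicate-free list of directions, the additional derivative occurs once if l is listed and
   not at all otherwise; commutation moves it to the front. *)
suff H r : uniq r -> F (midxS l M) r = if l \in r then jtd l (F M r) else F M r.
  by have := H (enum 'I_n) (enum_uniq _); rewrite mem_enum.
elim: r => //= k r IH /andP[kr ur].
rewrite -/(F (midxS l M) r) -/(F M r) inE IH//.
case: (l =P k) => [lk|/eqP lk] /=; first by rewrite -lk midxSE lk (negbTE kr).
rewrite ffunE eq_sym (negbTE lk) add0n.
by case: ifP => // _; rewrite jtd_iter.
Qed.

Lemma jtdm0 f : jtdm (midx0 n) f = f.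
Proof. by rewrite /jtdm; elim: (enum 'I_n) => //= l r ->; rewrite ffunE. Qed.

End TotalDerivatives.

(** * Formal operators and their adjoints over abstract differential rings *)

Section FormalOperators.
Variables (n : nat) (A B : comPzRingType).
Variables (dA : 'I_n -> A -> A) (dB : 'I_n -> {additive B -> B}).
Variable phi : {rmorphism A -> B}.
Hypothesis dBM : forall l x y, dB l (x * y) = dB l x * y + x * dB l y.
Hypothesis dBC : forall l k x, dB l (dB k x) = dB k (dB l x).
Hypothesis phi_d : forall l a, phi (dA l a) = dB l (phi a).
Implicit Types (l : 'I_n) (w : seq 'I_n) (x y : B).

(* The list of the triples (a, (s, w)) stands for the operator that sends the
   family (g_s) to the sum of the a * d_w g_s. *)
Definition opseq r : Type := seq (A * ('I_r * seq 'I_n)).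

Definition dword w x : B := foldr (fun l => dB l) x w.

Definition opscale r (a : A) (ts : opseq r) : opseq r := [seq (a * t.1, t.2) | t <- ts].

(** The two terms per entry are those of the Leibniz rule for d_l composed with a * d_w. *)
Definition opder r l (ts : opseq r) : opseq r :=
  flatten [seq [:: (dA l t.1, t.2); (t.1, (t.2.1, l :: t.2.2))] | t <- ts].

Definition opders r w (ts : opseq r) : opseq r := foldr (@opder r) ts w.

Definition opcomp r s (ts : opseq s) (us : 'I_s -> opseq r) : opseq r :=
  flatten [seq opscale t.1 (opders t.2.2 (us t.2.1)) | t <- ts].

(** Each term a' * d_w of [us a] acting on the component k becomes the operator that sends g to
    (-1)^|w| d_w (a' * g_a). [opders] expands it by the Leibniz rule, so that the adjoint is again a
    list with coefficients in [A]. *)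
Definition opadj z s (us : 'I_z -> opseq s) (k : 'I_s) : opseq z :=
  flatten [seq flatten [seq opscale ((-1) ^+ size t.2.2) (opders t.2.2 [:: (t.1, (a, [::]))])
                       | t <- us a & t.2.1 == k] | a <- enum 'I_z].

Definition opapp r (ts : opseq r) (g : 'I_r -> B) : B :=
  \sum_(t <- ts) phi t.1 * dword t.2.2 (g t.2.1).

(* Formal adjoint of the k-th component of [ts], applied to h. *)
Definition opadjapp r (ts : opseq r) (k : 'I_r) (h : B) : B :=
  \sum_(t <- ts | t.2.1 == k) (-1) ^+ size t.2.2 * dword t.2.2 (phi t.1 * h).

Lemma dwordD w x y : dword w (x + y) = dword w x + dword w y.
Proof. by elim: w => //= l w ->; rewrite raddfD. Qed.

Lemma dword0 w : dword w 0 = 0.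
Proof. by elim: w => //= l w ->; rewrite raddf0. Qed.

HB.instance Definition _ w := GRing.isNmodMorphism.Build B B (dword w)
  (conj (dword0 w) (dwordD w)).

Lemma dword_comm l w x : dword w (dB l x) = dB l (dword w x).
Proof. by elim: w => //= k w ->; rewrite dBC. Qed.

Lemma opapp_flatten r (tss : seq (opseq r)) g :
  opapp (flatten tss) g = \sum_(ts <- tss) opapp ts g.
Proof. exact: big_flatten. Qed.

Lemma opapp_scale r a (ts : opseq r) g : opapp (opscale a ts) g = phi a * opapp ts g.
Proof.
by rewrite /opapp big_map mulr_sumr; apply: eq_bigr => t _ /=; rewrite rmorphM mulrA.
Qed.

Lemma opapp_der r l (ts : opseq r) g : opapp (opder l ts) g = dB l (opapp ts g).
Proof.
rewrite opapp_flatten big_map raddf_sum; apply: eq_bigr => t _.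
by rewrite /opapp !big_cons big_nil addr0 /= dBM phi_d.
Qed.

Lemma opapp_ders r w (ts : opseq r) g : opapp (opders w ts) g = dword w (opapp ts g).
Proof. by elim: w => //= l w IH; rewrite opapp_der IH. Qed.

Lemma opapp_comp r s (ts : opseq s) (us : 'I_s -> opseq r) g :
  opapp (opcomp ts us) g = opapp ts (fun k => opapp (us k) g).
Proof.
rewrite opapp_flatten big_map; apply: eq_bigr => t _.
by rewrite opapp_scale opapp_ders.
Qed.

Lemma opadjapp_flatten r (tss : seq (opseq r)) k h :
  opadjapp (flatten tss) k h = \sum_(ts <- tss) opadjapp ts k h.
Proof. exact: big_flatten. Qed.

Lemma opadjapp_scale r a (ts : opseq r) k h :
  opadjapp (opscale a ts) k h = opadjapp ts k (phi a * h).
Proof.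
rewrite /opadjapp big_map; apply: eq_bigr => t _ /=.
by rewrite rmorphM mulrA [phi a * _]mulrC.
Qed.

(** Integration by parts. The longer word l :: w carries the opposite sign, and the part of d_w d_l
    (a * h) in which d_l hits a cancels the term with coefficient d_l a. *)
Lemma opadjapp_der r l (ts : opseq r) k h :
  opadjapp (opder l ts) k h = - opadjapp ts k (dB l h).
Proof.
rewrite opadjapp_flatten big_map [in RHS]/opadjapp -sumrN [RHS]big_mkcond.
apply: eq_bigr => t _; rewrite /opadjapp !big_cons big_nil /=.
case: eqP => [_|//].
rewrite addr0 exprS -dword_comm dBM raddfD /= phi_d; ring.
Qed.

Lemma opadjapp_sum r (ts : opseq r) k (I : Type) (e : seq I) (h : I -> B) :
  opadjapp ts k (\sum_(i <- e) h i) = \sum_(i <- e) opadjapp ts k (h i).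
Proof.
rewrite /opadjapp exchange_big; apply: eq_bigr => t _.
by rewrite mulr_sumr raddf_sum mulr_sumr.
Qed.

Lemma opadjapp_sign r (ts : opseq r) k j h :
  opadjapp ts k ((-1) ^+ j * h) = (-1) ^+ j * opadjapp ts k h.
Proof.
rewrite -signr_odd !mulr_sign; case: (odd j) => //.
rewrite /opadjapp -sumrN; apply: eq_bigr => t _.
by rewrite mulrN raddfN mulrN.
Qed.

Lemma opadjapp_ders r w (ts : opseq r) k h :
  opadjapp (opders w ts) k h = (-1) ^+ size w * opadjapp ts k (dword w h).
Proof.
elim: w h => [|l w IH] h /=; first by rewrite expr0 mul1r.
by rewrite opadjapp_der IH dword_comm exprS mulN1r mulNr.
Qed.

Lemma opadjapp_comp r s (ts : opseq s) (us : 'I_s -> opseq r) k h :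
  opadjapp (opcomp ts us) k h = \sum_(i < s) opadjapp (us i) k (opadjapp ts i h).
Proof.
rewrite opadjapp_flatten big_map.
(* The inner adjoint is extended by zero to all terms of [ts], so that the sums can be exchanged;
   for a given term only the component on which it acts survives. *)
under [RHS]eq_bigr => i _ do rewrite {2}/opadjapp big_mkcond opadjapp_sum.
rewrite exchange_big; apply: eq_bigr => t _ /=.
rewrite opadjapp_scale opadjapp_ders -opadjapp_sign.
rewrite (bigD1 t.2.1)//= eqxx big1 ?addr0// => i /negbTE; rewrite eq_sym => ->.
by rewrite /opadjapp big1// => u _; rewrite mulr0 raddf0 mulr0.
Qed.

Lemma opapp_adj z s (us : 'I_z -> opseq s) k g :
  opapp (opadj us k) g = \sum_(a < z) opadjapp (us a) k (g a).
Proof.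
rewrite opapp_flatten big_map big_enum; apply: eq_bigr => a _ /=.
rewrite opapp_flatten big_map big_filter; apply: eq_bigr => t _.
by rewrite opapp_scale opapp_ders rmorph_sign /opapp big_seq1.
Qed.

(** The equality is one of values: lists of terms are not normal forms, and the two sides need not
    be the same list. *)
Lemma opapp_adj_comp z s r (us : 'I_z -> opseq s) (vs : 'I_s -> opseq r) k g :
  opapp (opadj (fun a => opcomp (us a) vs) k) g =
  opapp (opcomp (opadj vs k) (opadj us)) g.
Proof.
rewrite opapp_comp !opapp_adj.
under eq_bigr => a _ do rewrite opadjapp_comp.
rewrite exchange_big; apply: eq_bigr => i _ /=.
by rewrite opapp_adj opadjapp_sum.
Qed.

End FormalOperators.

(** * Words representing multi-indices, and iterated total derivatives *)

Section MultiIndexInduction.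
Variable n : nat.
Implicit Types (l : 'I_n) (M : midx n).

(** A section of [midx_of], which carries facts about words over to multi-indices and supplies the
    words of the terms built from an operator. *)
Definition midx_word M : seq 'I_n := flatten [seq nseq (M i) i | i <- enum 'I_n].

Lemma midx_wordK M : midx_of (midx_word M) = M.
Proof.
apply/ffunP => i; rewrite ffunE /midx_word count_flatten -map_comp.
rewrite (_ : _ \o _ = fun j => if j == i then M i else 0%N); last first.
  apply/funext => j /=; rewrite count_nseq /=.
  by case: eqP => [->|]; rewrite ?mul1n.
by rewrite sumnE big_map big_enum /= -big_mkcond /= big_pred1_eq.
Qed.

End MultiIndexInduction.

Section IteratedTotalDerivatives.
Variables (R : realType) (n : nat) (K : finType) (Om : jopen R n K).
Local Notation jfun := (jfun Om).
Implicit Types (f g : jfun) (l : 'I_n) (w : seq 'I_n).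

Lemma dword_jtdm w f : dword (@jtd R n K Om) w f = jtdm (midx_of w) f.
Proof.
by elim: w => [|l w /= ->]; rewrite ?midx_of_nil ?jtdm0// midx_of_cons jtdmS.
Qed.

Lemma jtdmD M f g : jtdm M (f + g) = jtdm M f + jtdm M g.
Proof. by rewrite -(midx_wordK M) -!dword_jtdm raddfD. Qed.

Lemma jtdm_0 M : jtdm M (0 : jfun) = 0.
Proof. by rewrite -(midx_wordK M) -dword_jtdm raddf0. Qed.

HB.instance Definition _ M := GRing.isNmodMorphism.Build jfun jfun (jtdm M)
  (conj (jtdm_0 M) (jtdmD M)).

Lemma tders_ev w f (h : (jidx n K -> R) -> R) p :
  (forall q, jset Om q -> h q = f q) -> jset Om p ->
  tders w h p = jtdm (midx_of w) f p.
Proof.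
move=> hf; rewrite -dword_jtdm; elim: w p => [|l w IH] p Up /=; first exact: hf.
exact: tder_ev.
Qed.

Lemma dword_cst (a : R) w f : dword (@jtd R n K Om) w (jcst Om a * f) =
  jcst Om a * dword (@jtd R n K Om) w f.
Proof. by elim: w => //= l w ->; rewrite jtdM jtd_cst mul0r add0r. Qed.

End IteratedTotalDerivatives.

(** * Jets of a vector bundle over Y, and pullback of functions from jets of Y *)

Section FiberJets.
Variables (R : realType) (n m : nat) (Om : jopen R n 'I_m) (r : nat).
Local Notation K := ('I_m + 'I_r)%type.

Definition proj_idx (c : jidx n 'I_m) : option (jidx n K) :=
  Some (match c with inl l => inl l | inr (i, M) => inr (inl i, M) end).

Definition lift_idx (c : jidx n K) : option (jidx n 'I_m) :=
  match c with
  | inl l => Some (inl l)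
  | inr (inl i, M) => Some (inr (i, M))
  | inr (inr _, _) => None
  end.

Lemma proj_idx_inj c d j : proj_idx c = Some j -> proj_idx d = Some j -> c = d.
Proof. by case: c d => [l|[i M]] [k|[j' M']] [<-] [] // -> // ->. Qed.

Lemma lift_idx_inj c d j : lift_idx c = Some j -> lift_idx d = Some j -> c = d.
Proof. by case: c d => [l|[[i|s] M]] [k|[[j'|t] M']] //= [<-] [] // -> // ->. Qed.

Lemma jproj_reindex : @jproj R n m r = @reindex R _ _ proj_idx (fun=> 0).
Proof. by apply/funext => p; apply/funext => -[l|[i M]]. Qed.

Lemma jlift_reindex v : (fun q => @jlift R n m r q v) = @reindex R _ _ lift_idx
  (fun c => match c with inr (inr s, M) => v (s, M) | _ => 0 end).
Proof. by apply/funext => p; apply/funext => -[l|[[i|s] M]]. Qed.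

Lemma jliftK p v : @jproj R n m r (jlift p v) = p.
Proof. by apply/funext => -[l|[i M]]. Qed.

Definition fib_set : set (jidx n K -> R) := [set p | jset Om (@jproj R n m r p)].

Lemma fib_set_open : open (fib_set : set {ptws (jidx n K) -> R}).
Proof.
rewrite /fib_set jproj_reindex.
exact: (@reindex_open R (jidx n 'I_m) (jidx n K) proj_idx (fun=> 0) Om (jset_open Om)).
Qed.

Lemma fib_set_order p q : (forall c : jidx n K, jorder c = 0%N -> p c = q c) ->
  fib_set p -> fib_set q.
Proof.
move=> pq; apply: jset_order => -[l|[i M]] h /=; first exact: (pq (inl l)).
exact: (pq (inr (inl i, M))).
Qed.

Definition fib_open : jopen R n K := JOpen fib_set_open fib_set_order.

Lemma pull_smooth (f : jfun Om) : smooth_on fib_open (fun p => f (@jproj R n m r p)).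
Proof.
rewrite /= /fib_set jproj_reindex.
exact: (@smooth_on_reindex _ _ _ proj_idx (fun=> 0) proj_idx_inj _ _
  (jset_open Om) (jfun_smooth f)).
Qed.

Lemma pull_order (f : jfun Om) : exists k, order_le k fib_open (fun p => f (@jproj R n m r p)).
Proof.
have [k fk] := jfun_order f; exists k => p q Up Uq pq; apply: fk => //.
by move=> [l|[i M]] h; apply: pq.
Qed.

Definition pull (f : jfun Om) : jfun fib_open := jfun_of (pull_smooth f) (pull_order f).

Lemma pullE f p : fib_set p -> pull f p = f (jproj p).
Proof. exact: (@jfun_ofE _ _ _ fib_open _ (pull_smooth f) (pull_order f) p). Qed.

Lemma pullD f g : pull (f + g) = pull f + pull g.
Proof. by apply: jfun_eq => p Up; rewrite jevD !pullE// jevD. Qed.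

Lemma pullM f g : pull (f * g) = pull f * pull g.
Proof. by apply: jfun_eq => p Up; rewrite jevM !pullE// jevM. Qed.

Lemma pull_cst a : pull (jcst Om a) = jcst fib_open a.
Proof. by apply: jfun_eq => p Up; rewrite pullE// !jcstE. Qed.

HB.instance Definition _ := GRing.isNmodMorphism.Build (jfun Om) (jfun fib_open) pull
  (conj (pull_cst 0) pullD).
HB.instance Definition _ := GRing.isMonoidMorphism.Build (jfun Om) (jfun fib_open) pull
  (conj (pull_cst 1) pullM).

Lemma pull_coord i M : pull (jcoord Om (inr (i, M))) = jcoord fib_open (inr (inl i, M)).
Proof. by apply: jfun_eq => p Up; rewrite pullE// !jcoordE. Qed.

Lemma jder_pull c d f : proj_idx c = Some d -> jder d (pull f) = pull (jder c f).
Proof.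
move=> cd; apply: jfun_eq => p Up; rewrite pullE// [RHS]jderE//.
rewrite -(@pder_ev _ _ _ fib_open d (pull f) (fun q => f (jproj q)))//; last first.
  by move=> q Uq; rewrite pullE.
rewrite jproj_reindex; exact: (@pder_reindex _ _ _ proj_idx (fun=> 0) proj_idx_inj f p _ _ cd).
Qed.

Lemma jder_pull_fiber s M f : jder (inr (inr s, M)) (pull f) = 0.
Proof.
apply: jfun_eq => p Up; rewrite jev0.
rewrite -(@pder_ev _ _ _ fib_open _ (pull f) (fun q => f (jproj q)))//; last first.
  by move=> q Uq; rewrite pullE.
rewrite jproj_reindex; apply: pder_reindex_out => -[[l|[i M']]] //.
Qed.

(** A pulled-back function does not depend on the fiber jet coordinates, so the terms by which the
    total derivative upstairs exceeds the one downstairs are zero. *)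
Lemma jtd_pull l f : jtd l (pull f) = pull (jtd l f).
Proof.
have hN := @jordP _ _ _ _ f.
rewrite (jtdE l hN) (@jtdE _ _ _ _ (jord f)); last first.
  move=> p q Up Uq pq; rewrite !pullE//; apply: hN => // -[k|[i M]] h; exact: pq.
rewrite rmorphD raddf_sum (@jder_pull (inl l))//=; congr (_ + _).
rewrite !big_allpairs_dep !big_enum /= big_sumType /= [X in _ + X]big1 ?addr0; last first.
  by move=> s _; rewrite big1// => M _; rewrite jder_pull_fiber mulr0.
apply: eq_bigr => i _; apply: eq_bigr => M _.
by rewrite rmorphM /= (@jder_pull (inr (i, M)))// pull_coord.
Qed.

End FiberJets.

(** * Formal operators as functions on jets; composition and [leta] in formal terms *)

Section LinearOperators.
Variables (R : realType) (n m : nat) (Om : jopen R n 'I_m).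
Local Notation A := (jfun Om).
Local Notation J r := (fib_open Om r).
Local Notation B r := (jfun (fib_open Om r)).
Implicit Types (l : 'I_n) (M : midx n).

Definition tdfib r l : {additive B r -> B r} := @jtd R n _ (J r) l.

Definition fcoord r (k : 'I_r) : B r := jcoord (J r) (inr (inr k, midx0 n)).

(** The operator is applied to the fiber coordinates of order zero, whose iterated total derivatives
    are the fiber jet coordinates. *)
Definition opfun r (ts : opseq n A r) : B r :=
  opapp (@tdfib r) (@pull R n m Om r) ts (@fcoord r).

Definition opcoef r (ts : opseq n A r) (k : 'I_r) M : A :=
  \sum_(t <- ts | (t.2.1 == k) && (midx_of t.2.2 == M)) t.1.

Definition opdeg r (ts : opseq n A r) : nat := \max_(t <- ts) size t.2.2.

Lemma dword_fcoord r (k : 'I_r) w :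
  dword (@tdfib r) w (fcoord k) = jcoord (J r) (inr (inr k, midx_of w)).
Proof.
elim: w => [|l w /= ->]; first by rewrite midx_of_nil.
by rewrite /tdfib /= jtd_coord midx_of_cons.
Qed.

Lemma opfunE r (ts : opseq n A r) p : fib_set Om p ->
  opfun ts p = \sum_(t <- ts) t.1 (jproj p) * p (inr (inr t.2.1, midx_of t.2.2)).
Proof.
move=> Up; rewrite /opfun /opapp jev_sum; apply: eq_bigr => t _.
by rewrite jevM dword_fcoord pullE// jcoordE.
Qed.

Lemma opcoefE r (ts : opseq n A r) (h : (wjidx n m r -> R) -> R) k M q :
  (forall p, fib_set Om p -> h p = opfun ts p) -> jset Om q ->
  h (jlift q (fun c => (c == (k, M))%:R)) = opcoef ts k M q.
Proof.
move=> hts Uq.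
have Up : fib_set Om (@jlift R n m r q (fun c => (c == (k, M))%:R)).
  by rewrite /fib_set /= jliftK.
rewrite hts// opfunE// jliftK /opcoef jev_sum [RHS]big_mkcond.
apply: eq_bigr => t _ /=; rewrite xpair_eqE.
by case: ifP => _; rewrite ?mulr1 ?mulr0.
Qed.

Lemma opcoef_deg r (ts : opseq n A r) k M : (opdeg ts < mdeg M)%N -> opcoef ts k M = 0.
Proof.
move=> h; rewrite /opcoef big_seq_cond big1// => t /and3P[tts _ /eqP ME].
suff : (mdeg M <= opdeg ts)%N by rewrite leqNgt h.
by rewrite -ME mdeg_midx_of /opdeg (big_rem t)//= leq_maxl.
Qed.

(** [opcoef] adds up the terms that share a multi-index, so any expression additive in the
    coefficient may be summed term by term. The target is left general: it is the reals for
    composition and the ring of jet functions for [leta]. *)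
Lemma sum_opcoef r (ts : opseq n A r) k N (V : nmodType) (G : midx n -> A -> V) :
  (forall M, G M 0 = 0) -> (forall M a b, G M (a + b) = G M a + G M b) ->
  (opdeg ts <= N)%N ->
  \sum_(M <- midxs n N) G M (opcoef ts k M) =
  \sum_(t <- ts | t.2.1 == k) G (midx_of t.2.2) t.1.
Proof.
move=> G0 GD; rewrite /opdeg /opcoef; elim: ts => [|t ts IH].
  by move=> _; rewrite big_nil big1// => M _; rewrite big_nil G0.
rewrite big_cons geq_max => /andP[tN tsN]; rewrite [RHS]big_cons -(IH tsN).
case: eqP => [tk|tk]; last first.
  by apply: eq_bigr => M _; rewrite big_cons (introF eqP tk).
have -> : G (midx_of t.2.2) t.1 =
    \sum_(M <- midxs n N) if midx_of t.2.2 == M then G M t.1 else 0.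
  rewrite (@big_midxs_pick n V N (midx_of t.2.2)) ?eqxx ?mdeg_midx_of//.
  by move=> M; rewrite eq_sym => /negbTE ->.
rewrite -big_split; apply: eq_bigr => M _ /=.
rewrite big_cons tk eqxx /=; case: ifP => _; first by rewrite GD.
by rewrite add0r.
Qed.

Lemma coefE r (ts : opseq n A r) (h : (wjidx n m r -> R) -> R) k (L : seq 'I_n) q :
  (forall p, fib_set Om p -> h p = opfun ts p) -> jset Om q ->
  coef h k L q =
  (mfact (midx_of L))%:R / (size L)`!%:R * opcoef ts k (midx_of L) q.
Proof. by move=> hts Uq; rewrite /coef (opcoefE _ _ hts Uq). Qed.

(** The weights in [coef] disappear through [fsum_words], and [sum_opcoef] regroups the remaining
    sum by the terms of [ts], which is the shape of [opapp_comp]. *)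
Lemma lcomp_ev r s z (u : 'I_z -> (wjidx n m s -> R) -> R)
    (u' : 'I_s -> (wjidx n m r -> R) -> R) a (ts : opseq n A s)
    (us : 'I_s -> opseq n A r) p :
  (forall q, fib_set Om q -> u a q = opfun ts q) ->
  (forall k q, fib_set Om q -> u' k q = opfun (us k) q) ->
  fib_set Om p -> lcomp u u' a p = opfun (opcomp (@jtd R n _ Om) ts us) p.
Proof.
move=> hu hu' Up.
pose X M := \sum_(k < s) opcoef ts k M (jproj p) * jtdm M (opfun (us k)) p.
transitivity (\sum_(L \in [set: seq 'I_n])
   (mfact (midx_of L))%:R / (size L)`!%:R * X (midx_of L)).
  apply: eq_fsbigr => L _; rewrite /X mulr_sumr; apply: eq_bigr => k _.
  by rewrite (coefE _ _ hu Up) (@tders_ev R n _ (J r) L (opfun (us k)) (u' k) p (hu' k) Up) mulrA.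
rewrite (@fsum_words n R (opdeg ts)); last first.
  by move=> M h; rewrite /X big1// => k _; rewrite opcoef_deg// jev0 mul0r.
rewrite exchange_big /=.
have E (k : 'I_s) : \sum_(M <- midxs n (opdeg ts)) opcoef ts k M (jproj p) * jtdm M (opfun (us k)) p
    = \sum_(t <- ts | t.2.1 == k) t.1 (jproj p) * jtdm (midx_of t.2.2) (opfun (us t.2.1)) p.
  rewrite (@sum_opcoef s ts k _ R (fun M a => a (jproj p) * jtdm M (opfun (us k)) p))//.
  - by apply: eq_bigr => t /eqP ->.
  - by move=> M; rewrite jev0 mul0r.
  - by move=> M b c; rewrite jevD mulrDl.
rewrite (eq_bigr _ (fun k _ => E k)).
rewrite /opfun opapp_comp; last 2 first.
- exact: jtdM.
- by move=> l b; rewrite /tdfib /= jtd_pull.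
rewrite [in RHS]/opapp jev_sum.
under eq_bigr do rewrite big_mkcond.
rewrite exchange_big; apply: eq_bigr => t _ /=.
rewrite (bigD1 t.2.1)//= eqxx big1 ?addr0; last first.
  by move=> k /negbTE; rewrite eq_sym => ->.
by rewrite jevM pullE// -dword_jtdm.
Qed.

Lemma leta_ev s z (u : 'I_z -> (wjidx n m s -> R) -> R) (us : 'I_z -> opseq n A s) k p :
  (forall a q, fib_set Om q -> u a q = opfun (us a) q) ->
  fib_set Om p -> leta u k p = opfun (opadj (@jtd R n _ Om) us k) p.
Proof.
move=> hu Up.
pose Y M : B z := \sum_(a < z) pull z (opcoef (us a) k M) * fcoord a.
pose X M := ((-1) ^+ mdeg M * jtdm M (Y M) : B z) p.
transitivity (\sum_(L \in [set: seq 'I_n])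
   (mfact (midx_of L))%:R / (size L)`!%:R * X (midx_of L)).
  apply: eq_fsbigr => L _; set c := (_ / _ : R).
  (* The weight of a word is a constant, so it passes through the total derivatives. *)
  rewrite (@tders_ev _ _ _ (J z) L (jcst (J z) c * Y (midx_of L))) //; last first.
    move=> q Uq; rewrite jevM jcstE// /Y jev_sum mulr_sumr; apply: eq_bigr => a _.
    by rewrite (coefE _ _ (hu a) Uq) -/c jevM pullE// /fcoord jcoordE// mulrA.
  rewrite -dword_jtdm dword_cst dword_jtdm /X mdeg_midx_of jev_sign jevM jcstE//.
  by rewrite mulrCA.
pose N := \max_(a < z) opdeg (us a).
have aN a : (opdeg (us a) <= N)%N by rewrite /N (bigD1 a)//= leq_maxl.
rewrite (@fsum_words n R N); last first.
  move=> M h; rewrite /X /Y big1 ?raddf0 ?jev_sign ?jev0 ?mulr0// => a _.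
  by rewrite opcoef_deg ?raddf0 ?mul0r// (leq_ltn_trans (aN a) h).
rewrite /opfun opapp_adj; last 2 first.
- exact: jtdM.
- by move=> l b; rewrite /tdfib /= jtd_pull.
(* The values at p are replaced by the functions themselves, so that additivity of [jtdm] can be
   used in the ring. *)
rewrite -jev_sum; congr (jev _ p).
transitivity (\sum_(a < z) \sum_(M <- midxs n N)
    (-1) ^+ mdeg M * jtdm M (pull z (opcoef (us a) k M) * fcoord a)).
  rewrite exchange_big; apply: eq_bigr => M _.
  by rewrite /Y raddf_sum mulr_sumr.
apply: eq_bigr => a _.
rewrite (@sum_opcoef s (us a) k N (B z) (fun M b =>
   (-1) ^+ mdeg M * jtdm M (pull z b * fcoord a)))//.
- by apply: eq_bigr => t _; rewrite mdeg_midx_of -dword_jtdm.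
- by move=> M; rewrite raddf0 mul0r raddf0 mulr0.
- by move=> M b c; rewrite raddfD mulrDl raddfD mulrDr.
Qed.

End LinearOperators.

(** * Linear operators in one chart as finite formal sums, and the local identity *)

Section LocalOperators.
Variables (R : realType) (n m : nat) (Om : jopen R n 'I_m).
Local Notation A := (jfun Om).

Definition linear_operator r (F : (wjidx n m r -> R) -> R) : Prop :=
  exists N, [/\ order_le N (fib_set Om (r := r)) F, smooth_on (fib_set Om (r := r)) F &
    forall p v v' (t : R), jset Om p ->
      F (jlift p (fun c => t * v c + v' c)) = t * F (jlift p v) + F (jlift p v')].

Lemma linear_operator_sum r (F : (wjidx n m r -> R) -> R) q (I : Type) (e : seq I)
    (a : I -> R) (b : I -> 'I_r * midx n -> R) :
  linear_operator F -> jset Om q ->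
  F (jlift q (fun c => \sum_(i <- e) a i * b i c)) =
  \sum_(i <- e) a i * F (jlift q (b i)).
Proof.
move=> [N [_ _ Flin]] Uq; elim: e => [|i e IH].
  (* At zero arguments with t = 1, linearity reads F(0) = F(0) + F(0), which gives the empty sum. *)
  have := Flin q (fun=> 0) (fun=> 0) 1 Uq.
  rewrite (_ : (fun=> 1 * 0 + 0) = (fun=> 0 : R)); last first.
    by apply/funext => c; rewrite mul1r addr0.
  rewrite mul1r.
  rewrite (_ : (fun c => \sum_(i <- [::]) a i * b i c) = fun=> 0); last first.
    by apply/funext => c; rewrite big_nil.
  by rewrite big_nil => h; apply: (addrI (F (jlift q (fun=> 0)))); rewrite addr0 -h.
rewrite big_cons -IH -Flin//; congr (F (jlift q _)).
by apply/funext => c; rewrite big_cons.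
Qed.

Lemma smooth_on_jlift r (F : (wjidx n m r -> R) -> R) v :
  smooth_on (fib_set Om (r := r)) F -> smooth_on Om (fun q => F (jlift q v)).
Proof.
move=> hF; pose d (c : wjidx n m r) := match c with inr (inr s, M) => v (s, M) | _ => 0 end.
have := @smooth_on_reindex R _ _ (@lift_idx n m r) d (@lift_idx_inj n m r) _ _
  (@fib_set_open R n m Om r) hF.
have E q : reindex (@lift_idx n m r) d q = jlift q v.
  by rewrite -[RHS]/((fun q => @jlift R n m r q v) q) jlift_reindex.
rewrite (_ : [set _ | _] = jset Om); last first.
  by apply/funext => q; rewrite /mkset E /fib_set /= jliftK.
by under eq_fun => q do rewrite E.
Qed.

Lemma order_le_jlift r (F : (wjidx n m r -> R) -> R) N v :
  order_le N (fib_set Om (r := r)) F -> order_le N Om (fun q => F (jlift q v)).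
Proof.
move=> hF p q Up Uq pq; apply: hF; rewrite ?/fib_set /= ?jliftK//.
by move=> [l|[[i|s] M]] h //=; apply: pq.
Qed.

(** The coefficients are the values of F on the basis vectors of the fiber, as smooth functions on
    jets of Y. The finite order of F leaves only finitely many of them to account for. *)
Lemma linear_operator_opfun r (F : (wjidx n m r -> R) -> R) : linear_operator F ->
  exists ts : opseq n A r, forall p, fib_set Om p -> F p = opfun ts p.
Proof.
move=> hF; have [N [Fo Fs _]] := hF.
pose e (i : 'I_r * midx n) (c : 'I_r * midx n) : R := (c == i)%:R.
pose cf i : A := jfun_of (smooth_on_jlift (e i) Fs)
  (ex_intro _ N (@order_le_jlift r F N (e i) Fo)).
pose js := [seq (s, M) | s <- enum 'I_r, M <- midxs n N].
exists [seq (cf i, (i.1, midx_word i.2)) | i <- js] => p Up.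
rewrite opfunE// big_map /=.
have mem_js i : (i \in js) = (mdeg i.2 <= N)%N by exact: (@mem_jidxs n 'I_r).
(* The fiber coordinates above order N are set to zero, which F does not see; what remains is a
   finite combination of basis vectors. *)
transitivity (F (jlift (jproj p)
    (fun c => \sum_(i <- js) p (inr (inr i.1, i.2)) * e i c))).
  refine (Fo _ _ Up _ _); first by rewrite /fib_set /= jliftK.
  move=> [l|[[i|s] M]] h //=.
  rewrite (bigD1_seq (s, M)) ?mem_js//=; last exact: (@jidxs_uniq n 'I_r).
  rewrite /e eqxx mulr1 big1 ?addr0// => i /negbTE; rewrite eq_sym => ->.
  by rewrite mulr0.
rewrite (linear_operator_sum _ _ _ hF Up); apply: eq_bigr => i _.
by rewrite midx_wordK mulrC; congr (_ * _); rewrite jfun_ofE.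
Qed.

Lemma leta_lcomp r s z (u : 'I_z -> (wjidx n m s -> R) -> R)
    (u' : 'I_s -> (wjidx n m r -> R) -> R) k p :
  (forall a, linear_operator (u a)) -> (forall a, linear_operator (u' a)) ->
  fib_set Om p ->
  leta (lcomp u u') k p = lcomp (leta u') (leta u) k p.
Proof.
move=> hu hu' Up.
have [ts hts] := choice (fun a => linear_operator_opfun (hu a)).
have [us hus] := choice (fun a => linear_operator_opfun (hu' a)).
rewrite (@leta_ev R n m Om r z (lcomp u u')
  (fun a => opcomp (@jtd R n _ Om) (ts a) us) k p _ Up); last first.
  by move=> a q Uq; exact: (lcomp_ev (hts a) hus Uq).
rewrite (@lcomp_ev R n m Om z s r (leta u') (leta u) k
  (opadj (@jtd R n _ Om) us k) (opadj (@jtd R n _ Om) ts) p _ _ Up).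
- congr (jev _ p); apply: opapp_adj_comp.
  + exact: jtdM.
  + exact: jtdC.
  + by move=> l b; rewrite /tdfib /= jtd_pull.
- by move=> q Uq; exact: (leta_ev _ hus Uq).
- by move=> a q Uq; exact: (leta_ev _ hts Uq).
Qed.

End LocalOperators.

(** * From bundle charts to domains of jets *)

Section BundleJets.
Variables (R : realType) (n m : nat) (B : fbundle R n m).

Definition base_idx (c : ('I_n + 'I_m)%type) : option (jidx n 'I_m) :=
  Some (match c with inl l => inl l | inr i => inr (i, midx0 n) end).

Lemma jbase_reindex : @jbase R n m = @reindex R _ _ base_idx (fun=> 0).
Proof. by apply/funext => p; apply/funext => -[]. Qed.

Lemma jdom_open i : is_fbundle B -> open (@jdom R n m B i : set {ptws (jidx n 'I_m) -> R}).
Proof.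
move=> [_ _ _ _ /(_ i)[_ [[_ oY _ _ _] _] _ _]].
rewrite /jdom jbase_reindex.
exact: (@reindex_open R _ _ base_idx (fun=> 0) _ oY).
Qed.

Lemma jdom_order i p q : (forall c, jorder c = 0%N -> p c = q c) ->
  @jdom R n m B i p -> @jdom R n m B i q.
Proof.
move=> pq; rewrite /jdom /=; suff -> : jbase p = jbase q by [].
by apply/funext => -[l|k]; apply: pq; rewrite //= mdeg0.
Qed.

Definition jdom_jopen (hB : is_fbundle B) i : jopen R n 'I_m :=
  JOpen (jdom_open i hB) (@jdom_order i).

Lemma Diff_linear (hB : is_fbundle B) (W Z : vbundle B) (F : opfam W Z) i a :
  Diff W Z F -> linear_operator (jdom_jopen hB i) (F i a).
Proof. by move=> [[N /(_ i a)[h1 h2 h3]] _]; exists N. Qed.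

End BundleJets.

Theorem proposition8p2 (R : realType) (n m : nat) (B : fbundle R n m)
    (hB : is_fbundle B) (E' E Q : vbundle B)
    (hE' : is_vbundle E') (hE : is_vbundle E) (hQ : is_vbundle Q) :
  (forall (u : opfam E Q) (u' : opfam E' E),
     Diff E Q u -> Diff E' E u' ->
     op_eq (eta (op_comp u u')) (op_comp (eta u') (eta u))) /\
  (forall (D : opfam (ddual Q) (ddual E)) (D' : opfam (ddual E) (ddual E')),
     Diff (ddual Q) (ddual E) D -> Diff (ddual E) (ddual E') D' ->
     op_eq (eta_dual (op_comp D' D)) (op_comp (eta_dual D) (eta_dual D'))).
Proof.
(* Both halves are [leta_lcomp] in the chart i; in the second, [D'] is the outer operator. A
   density-dual has the rank of its bundle, so the component indices match by conversion. *)
split=> [u u' hu hu' | D D' hD hD'] i a p Up.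
- apply: (@leta_lcomp R n m (jdom_jopen hB i) _ _ _ (u i) (u' i) a p _ _ Up) => b.
    exact: (@Diff_linear R n m B hB E Q).
  exact: (@Diff_linear R n m B hB E' E).
- apply: (@leta_lcomp R n m (jdom_jopen hB i) _ _ _ (D' i) (D i) a p _ _ Up) => b.
    exact: (@Diff_linear R n m B hB (ddual E) (ddual E')).
  exact: (@Diff_linear R n m B hB (ddual Q) (ddual E)).
Qed.
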